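(* Let $r \ge 1$. Every non-deterministically testable $r$-graph parameter $f$ is testable.
   Context: Notation: $[n]=\{1,\dots,n\}$. A simple $r$-graph ($r$-uniform hypergraph) on $n$ vertices is a subset $G\subseteq \binom{[n]}{r}$. For a finite set $C$, a $C$-colored $r$-graph on $[n]$ is a map $\mathbf G$ assigning to each $e\in\binom{[n]}{r}$ exactly one color $\mathbf G(e)\in C$; ''$k$-colored'' means $C=[k]$. A simple $r$-graph is regarded as a $2$-colored $r$-graph (one color for edges, the other for non-edges). An $r$-graph parameter (resp. a $C$-colored $r$-graph parameter) is a real-valued function on the set of all finite simple (resp. $C$-colored) $r$-graphs that is invariant under relabeling of the vertices. For $q\ge 1$ and a (simple or colored) $r$-graph $G$ on $n\ge q$ vertices, $\mathbb G(q,G)$ denotes the random $r$-graph on $q$ vertices obtained by choosing a uniformly random subset $S$ of the vertex set with $|S|=q$ and taking the induced sub-$r$-graph $G[S]$. Testable: an $r$-graph parameter $f$ is testable if for every $\varepsilon>0$ there is a positive integer $q_f(\varepsilon)$ such that for every simple $r$-graph $G$ with at least $q_f(\varepsilon)$ vertices, $$\mathbb P\big(|f(G)-f(\mathbb G(q_f(\varepsilon),G))|>\varepsilon\big)<\varepsilon .$$ Testability of parameters of $C$-colored $r$-graphs is defined in the same way, with $C$-colored $r$-graphs in place of simple ones. $k$-coloring: a $k$-coloring of a $t$-colored $r$-graph $\mathbf G$ on $[n]$ is a $[t]\times[k]$-colored $r$-graph $\hat{\mathbf G}$ on $[n]$ such that for every $e\in\binom{[n]}{r}$ the first coordinate of $\hat{\mathbf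 G}(e)$ is $\mathbf G(e)$. A $[2]\times[k]$-colored $r$-graph is also called $2k$-colored. Non-deterministically testable: an $r$-graph parameter $f$ is non-deterministically testable if there exist an integer $k\ge1$ and a testable $2k$-colored $r$-graph parameter $g$ (the witness) such that for every simple $r$-graph $G$, $f(G)=\max_{\mathbf G} g(\mathbf G)$, where the maximum is over all $k$-colorings $\mathbf G$ of $G$ (with $G$ regarded as a $2$-colored $r$-graph). *)

(* Defs.v *)
From mathcomp Require Import all_boot all_order all_algebra all_fingroup.
From mathcomp Require Import reals.

Set Implicit Arguments.
Unset Strict Implicit.
Unset Printing Implicit Defensive.

Import Order.TTheory GRing.Theory Num.Theory.
Local Open Scope ring_scope.

Definition redge (r : nat) (V : finType) := {e : {set V} | #|e| == r}.

Lemma map_redge_subproof (r : nat) (V W : finType) (h : V -> W)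
  (h_inj : injective h) (e : redge r V) : #|h @: val e| == r.
Proof. by rewrite card_imset // (valP e). Qed.

Definition map_redge (r : nat) (V W : finType) (h : V -> W)
    (h_inj : injective h) (e : redge r V) : redge r W :=
  Sub (h @: val e) (map_redge_subproof h_inj e).

(** The vertex set [[n]] is ['I_n]. *)
Definition sgraph (r n : nat) := {set redge r 'I_n}.

Definition cgraph (C : finType) (r n : nat) := {ffun redge r 'I_n -> C}.

Definition spullback (r m n : nat) (h : 'I_m -> 'I_n) (h_inj : injective h)
    (G : sgraph r n) : sgraph r m :=
  [set e | map_redge h_inj e \in G].

Definition cpullback (C : finType) (r m n : nat) (h : 'I_m -> 'I_n)
    (h_inj : injective h) (G : cgraph C r n) : cgraph C r m :=
  [ffun e => G (map_redge h_inj e)].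

Definition srelabel (r n : nat) (s : 'S_n) (G : sgraph r n) : sgraph r n :=
  spullback (@perm_inj _ s) G.

Definition crelabel (C : finType) (r n : nat) (s : 'S_n) (G : cgraph C r n) :
    cgraph C r n :=
  cpullback (@perm_inj _ s) G.

(** [G[S]], with the vertices of [S] renamed [0, ..., #|S| - 1] along
    [enum_val]; graph parameters do not depend on the choice of this naming. *)
Definition sinduced (r n : nat) (G : sgraph r n) (S : {set 'I_n}) :
    sgraph r #|S| :=
  spullback (@enum_val_inj _ (mem S)) G.

Definition cinduced (C : finType) (r n : nat) (G : cgraph C r n)
    (S : {set 'I_n}) : cgraph C r #|S| :=
  cpullback (@enum_val_inj _ (mem S)) G.

Record sparam (R : realType) (r : nat) := SParam {
  sparam_fun :> forall n : nat, sgraph r n -> R;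
  sparam_relabel : forall (n : nat) (s : 'S_n) (G : sgraph r n),
    sparam_fun (srelabel s G) = sparam_fun G }.

Record cparam (R : realType) (C : finType) (r : nat) := CParam {
  cparam_fun :> forall n : nat, cgraph C r n -> R;
  cparam_relabel : forall (n : nat) (s : 'S_n) (G : cgraph C r n),
    cparam_fun (crelabel s G) = cparam_fun G }.

(** Probability of the event [P] for a uniformly random [S] of cardinality [q];
    meaningful only for [q <= n]. *)
Definition sample_prob (R : realType) (n q : nat) (P : pred {set 'I_n}) : R :=
  #|[set S : {set 'I_n} | (#|S| == q) && P S]|%:R
  / #|[set S : {set 'I_n} | #|S| == q]|%:R.

Definition testable (R : realType) (r : nat) (f : sparam R r) : Prop :=
  forall eps : R, 0 < eps ->
  exists q : nat, (0 < q)%N /\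
  forall (n : nat) (G : sgraph r n), (q <= n)%N ->
    sample_prob R q
      (fun S : {set 'I_n} => `|f n G - f #|S| (sinduced G S)| > eps) < eps.

Definition ctestable (R : realType) (C : finType) (r : nat)
    (g : cparam R C r) : Prop :=
  forall eps : R, 0 < eps ->
  exists q : nat, (0 < q)%N /\
  forall (n : nat) (G : cgraph C r n), (q <= n)%N ->
    sample_prob R q
      (fun S : {set 'I_n} => `|g n G - g #|S| (cinduced G S)| > eps) < eps.

Definition two_colored (r n : nat) (G : sgraph r n) : cgraph 'I_2 r n :=
  [ffun e => if e \in G then ord0 else ord_max].

Definition kcoloring (t k r n : nat) (G : cgraph 'I_t r n)
    (H : cgraph ('I_t * 'I_k)%type r n) : Prop :=
  forall e : redge r 'I_n, (H e).1 = G e.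

Definition is_max (R : realType) (T : Type) (P : T -> Prop) (F : T -> R)
    (m : R) : Prop :=
  (exists x, P x /\ F x = m) /\ (forall x, P x -> F x <= m).

Definition nondet_testable (R : realType) (r : nat) (f : sparam R r) : Prop :=
  exists k : nat, (1 <= k)%N /\
  exists g : cparam R ('I_2 * 'I_k)%type r, ctestable g /\
  forall (n : nat) (G : sgraph r n),
    is_max (fun H => kcoloring (two_colored G) H) (fun H => g n H) (f n G).

(* Main.v *)
Require Import Defs.
From mathcomp Require Import all_boot all_order all_algebra all_fingroup.
From mathcomp Require Import reals.
From mathcomp Require Import ring lra zify.

(** Let [g] witness [f], let [H_S] be an optimal coloring of the sample [G[S]],
    [|S| = q], and let [Q] be a sample size for [g]. Restricting an optimal
    coloring of [G] shows that [f(G[S])] is rarely much below [f(G)]. Conversely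
    it is enough to find a coloring of [G] whose [Q]-vertex samples look like
    those of a random [H_S]: since [g] is determined by [Q]-samples up to a
    small error, [f(G[S])] is then rarely much above [f(G)].

    To find it, move [G] by a random permutation of the vertices, fix palette
    sizes [b 0 >= ... >= b (r+1) = 0], and let [P] be the set of the first [b 0]
    vertices. For the sets [f] disjoint from [P], by increasing size, choose
    jointly the colors of all [f :|: B] with [B] inside the palette of size
    [b (#|f| + 1)], following their law in the pairs [(G, H_S)] conditioned on
    [G] over [P :|: f] and on the colors chosen for the proper subsets of [f].
    Revealing [Q] further vertices adds to this condition everything else that
    was chosen inside a [Q]-set; it changes the conditional law in mean square
    by the increment of an energy that lies in [[0, 1]], is monotone in the
    palette, and depends only on the sizes involved, because a random
    permutation is exchangeable. A pigeonhole argument makes all the increments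
    small for palette sizes bounded independently of [G]. *)

Set Implicit Arguments.
Unset Strict Implicit.
Unset Printing Implicit Defensive.
Import Order.TTheory GRing.Theory Num.Theory.
Local Open Scope ring_scope.

(** * Averages, conditional expectation and energy *)

Section Average.
Variables (R : realFieldType) (W : finType).
Implicit Types (A : {set W}) (u v : W -> R).

Definition avg A u : R := (\sum_(w in A) u w) / #|A|%:R.

Lemma avg0 u : avg set0 u = 0.
Proof. by rewrite /avg big_set0 mul0r. Qed.

Lemma eq_avg A u v : (forall w, w \in A -> u w = v w) -> avg A u = avg A v.
Proof. by move=> uv; rewrite /avg (eq_bigr v). Qed.

Lemma le_avg A u v : (forall w, w \in A -> u w <= v w) -> avg A u <= avg A v.
Proof. by move=> uv; rewrite /avg ler_wpM2r ?invr_ge0 ?ler0n ?ler_sum. Qed.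

Lemma avg_sum (I : finType) (Q : pred I) A (u : I -> W -> R) :
  avg A (fun w => \sum_(i | Q i) u i w) = \sum_(i | Q i) avg A (u i).
Proof. by rewrite /avg exchange_big mulr_suml. Qed.

Lemma avgD A u v : avg A (fun w => u w + v w) = avg A u + avg A v.
Proof. by rewrite /avg big_split mulrDl. Qed.

Lemma avgB A u v : avg A (fun w => u w - v w) = avg A u - avg A v.
Proof. by rewrite /avg sumrB mulrBl. Qed.

Lemma avgZ A a u : avg A (fun w => a * u w) = a * avg A u.
Proof. by rewrite /avg -mulr_sumr mulrA. Qed.

Lemma avg_const A a : A != set0 -> avg A (fun=> a) = a.
Proof.
by move=> A0; rewrite /avg sumr_const -[a *+ _]mulr_natr mulfK ?pnatr_eq0 ?cards_eq0.
Qed.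

Lemma avg_ge0 A u : (forall w, w \in A -> 0 <= u w) -> 0 <= avg A u.
Proof. by move=> u0; rewrite divr_ge0 ?sumr_ge0. Qed.

Lemma avg_le A u a : 0 <= a -> (forall w, w \in A -> u w <= a) -> avg A u <= a.
Proof.
move=> a0 ua; have [->|A0] := eqVneq A set0; first by rewrite avg0.
by rewrite -[leRHS](avg_const a A0) le_avg.
Qed.

Lemma avg_preimset (h : W -> W) A u : bijective h ->
  avg (h @^-1: A) (fun w => u (h w)) = avg A u.
Proof.
move=> hb; rewrite /avg on_card_preimset; last exact: onW_bij.
rewrite [in RHS](reindex h) /=; last exact: onW_bij.
by congr (_ / _); apply: eq_bigl => w; rewrite !inE.
Qed.

Definition fiber (K : eqType) (c : W -> K) (w : W) : {set W} :=
  [set w' | c w' == c w].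

Lemma fiber_neq0 (K : eqType) (c : W -> K) w : fiber c w != set0.
Proof. by apply/set0Pn; exists w; rewrite inE. Qed.

Definition refines (K L : eqType) (h : W -> K) (c : W -> L) :=
  forall w w', h w = h w' -> c w = c w'.

Lemma refines_fiber (K L : eqType) (h : W -> K) (c : W -> L) w w' :
  refines h c -> h w = h w' -> fiber c w = fiber c w'.
Proof. by move=> hc e; rewrite /fiber (hc _ _ e). Qed.

Definition cexp (K : eqType) (c : W -> K) u (w : W) : R := avg (fiber c w) u.

Lemma sum_cexp (K : eqType) (c : W -> K) u v :
  refines c v -> \sum_w v w * cexp c u w = \sum_w v w * u w.
Proof.
move=> cv.
transitivity (\sum_w \sum_(w' | c w' == c w) v w * u w' / #|fiber c w|%:R).
  apply: eq_bigr => w _; rewrite /cexp /avg mulrA mulr_sumr mulr_suml.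
  by apply: eq_bigl => w'; rewrite inE.
rewrite (exchange_big_dep xpredT) //=; apply: eq_bigr => w' _.
transitivity (\sum_(w in fiber c w') v w' * u w' / #|fiber c w'|%:R).
  apply: eq_big => [w|w /eqP e]; first by rewrite inE eq_sym.
  by rewrite (cv _ _ e) (@refines_fiber _ _ c c w' w).
rewrite sumr_const -[_ *+ _]mulr_natr divfK // pnatr_eq0 cards_eq0.
exact: fiber_neq0.
Qed.

Lemma refines_cexp (K L : eqType) (h : W -> K) (c : W -> L) u :
  refines h c -> refines h (cexp c u).
Proof. by move=> hc w w' e; rewrite /cexp (refines_fiber hc e). Qed.

(** Pythagoras: as [c] is coarser than [h], [sum_cexp] used for [h] and then for [c] evaluates the
    cross term. *)
Lemma sum_cexp_sqB (K L : eqType) (h : W -> K) (c : W -> L) u :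
  refines h c ->
  \sum_w (cexp h u w - cexp c u w) ^+ 2 =
  \sum_w cexp h u w ^+ 2 - \sum_w cexp c u w ^+ 2.
Proof.
move=> hc.
have e1 : \sum_w cexp c u w * cexp h u w = \sum_w cexp c u w ^+ 2.
  rewrite (sum_cexp _ (refines_cexp u hc)) -(@sum_cexp _ c u) //.
  exact: refines_cexp.
under eq_bigr do rewrite sqrrB mulrC.
by rewrite big_split /= sumrB sumrMnl e1; ring.
Qed.

(** The probability that two samples, independent given [c], agree on [z]. *)
Definition energy (K L : eqType) (c : W -> K) (z : W -> L) : R :=
  avg setT (fun w => cexp c (fun w' => (z w' == z w)%:R) w).

(** Splits the collision probability by the common value [a]; the projection property turns each
    part into a squared norm, to which Pythagoras applies. *)
Lemma energyE (K : eqType) (Z : finType) (c : W -> K) (z : W -> Z) :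
  energy c z =
  (\sum_(a : Z) \sum_w cexp c (fun w' => (z w' == a)%:R) w ^+ 2) / #|W|%:R.
Proof.
rewrite /energy {1}/avg cardsT; congr (_ / _).
under [RHS]eq_bigr => a _.
  rewrite (_ : \sum_w _ = \sum_w cexp c (fun w' => (z w' == a)%:R) w *
     (z w == a)%:R); last first.
    rewrite -(@sum_cexp _ c) //; last exact: refines_cexp.
  over.
rewrite exchange_big; apply: eq_big => [w|w _]; first by rewrite inE.
rewrite (bigD1 (z w)) //= eqxx mulr1 big1 ?addr0 // => a az.
by rewrite eq_sym (negPf az) mulr0.
Qed.

Lemma energy_ge0 (K L : eqType) (c : W -> K) (z : W -> L) : 0 <= energy c z.
Proof. by apply: avg_ge0 => w _; apply: avg_ge0 => w' _; rewrite ler0n. Qed.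

Lemma energy_le1 (K L : eqType) (c : W -> K) (z : W -> L) : energy c z <= 1.
Proof.
by apply: avg_le => // w _; apply: avg_le => // w' _; rewrite lern1 leq_b1.
Qed.

Lemma eq_energy (K K' L L' : eqType) (c : W -> K) (c' : W -> K')
    (z : W -> L) (z' : W -> L') :
  (forall w' w, (c w' == c w) = (c' w' == c' w)) ->
  (forall w' w, (z w' == z w) = (z' w' == z' w)) ->
  energy c z = energy c' z'.
Proof.
move=> cc zz; apply: eq_avg => w _; rewrite /cexp.
rewrite (_ : fiber c w = fiber c' w); last by apply/setP=> v; rewrite !inE cc.
by apply: eq_avg => v _; rewrite zz.
Qed.

Lemma energy_reindex (K L : eqType) (c : W -> K) (z : W -> L) (h : W -> W) :
  bijective h -> energy (fun w => c (h w)) (fun w => z (h w)) = energy c z.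
Proof.
move=> hb; rewrite /energy -[RHS](avg_preimset _ _ hb) preimsetT.
apply: eq_avg => w _; rewrite /cexp -[RHS](avg_preimset _ _ hb).
by congr avg; apply/setP=> w'; rewrite !inE.
Qed.

Lemma le_energy (K K' : eqType) (Z : finType) (h : W -> K) (c : W -> K')
    (z : W -> Z) : refines h c -> energy c z <= energy h z.
Proof.
move=> hc; rewrite !energyE ler_wpM2r ?invr_ge0 ?ler0n //; apply: ler_sum => a _.
by rewrite -subr_ge0 -(sum_cexp_sqB _ hc) sumr_ge0 // => w _; rewrite sqr_ge0.
Qed.

(** Expand over the values [a] of [z]. As [v a] is determined by [h], the indicator of [z = a] may
    be replaced by its conditional probability given [h]. Passing to [c] costs [v a w * d a w],
    which is at most [d a w ^+ 2 / eta + eta], and the squares, summed over [a], average to at most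
    the energy increment. *)
Lemma avg_resample (K K' : eqType) (Z : finType) (h : W -> K) (c : W -> K')
    (z : W -> Z) (Zs : {set Z}) (v : Z -> W -> R) (eta : R) :
  0 < eta -> (0 < #|W|)%N -> refines h c ->
  (forall w, z w \in Zs) ->
  (forall a w, 0 <= v a w <= 1) -> (forall a, refines h (v a)) ->
  avg setT (fun w => v (z w) w) <=
    avg setT (fun w => cexp c (fun w' => v (z w') w) w)
    + (energy h z - energy c z) / eta + #|Zs|%:R * eta.
Proof.
move=> eta0 W0 hc zZ v01 hv.
pose d a w := cexp h (fun w' => (z w' == a)%:R) w -
              cexp c (fun w' => (z w' == a)%:R) w.
have NW : #|W|%:R != 0 :> R by rewrite pnatr_eq0 -lt0n.
have split_z (F : W -> R) (w : W) (A : {set W}) :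
    avg A (fun w' => v (z w') w) =
    \sum_(a in Zs) v a w * avg A (fun w' => (z w' == a)%:R).
  under [RHS]eq_bigr do rewrite -avgZ.
  rewrite -avg_sum; apply: eq_avg => w' _.
  rewrite (bigD1 (z w')) //= eqxx mulr1 big1 ?addr0 // => a /andP[_ az].
  by rewrite eq_sym (negPf az) mulr0.
have lhs : avg setT (fun w => v (z w) w) =
    avg setT (fun w => \sum_(a in Zs) v a w * cexp h (fun w' => (z w' == a)%:R) w).
  rewrite avg_sum /avg -mulr_suml; congr (_ / _).
  under [RHS]eq_bigr => a _.
    under eq_bigl do rewrite inE.
    rewrite (sum_cexp _ (hv a)); over.
  rewrite exchange_big; apply: eq_big => [w|w _]; first by rewrite inE.
  rewrite (bigD1 (z w)) //= eqxx mulr1 big1 ?addr0 // => a /andP[_ az].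
  by rewrite eq_sym (negPf az) mulr0.
have rhs : avg setT (fun w => cexp c (fun w' => v (z w') w) w) =
    avg setT (fun w => \sum_(a in Zs) v a w * cexp c (fun w' => (z w' == a)%:R) w).
  by apply: eq_avg => w _; rewrite /cexp split_z.
have dE : energy h z - energy c z = avg setT (fun w => \sum_a d a w ^+ 2).
  rewrite !energyE -mulrBl -sumrB avg_sum /avg -mulr_suml cardsT.
  congr (_ / _); apply: eq_bigr => a _; rewrite -(sum_cexp_sqB _ hc).
  by apply: eq_bigl => w; rewrite inE.
have T0 : [set: W] != set0 by rewrite -cards_eq0 cardsT -lt0n.
rewrite -addrA -lerBlDl lhs rhs -avgB dE mulrC -avgZ.
rewrite -(avg_const (#|Zs|%:R * eta) T0) -avgD; apply: le_avg => w _.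
rewrite -sumrB.
have sub : \sum_(a in Zs) d a w ^+ 2 <= \sum_a d a w ^+ 2.
  by rewrite [leRHS](bigID (mem Zs)) /= lerDl sumr_ge0 // => a _; rewrite sqr_ge0.
apply: (@le_trans _ _ (\sum_(a in Zs) (eta^-1 * d a w ^+ 2 + eta))); last first.
  rewrite big_split /= -mulr_sumr sumr_const -[eta *+ _]mulr_natl lerD2r.
  by rewrite ler_pM2l ?invr_gt0.
apply: ler_sum => a _; rewrite -mulrBr -[cexp h _ w - _]/(d a w).
have /andP[v0 v1] := v01 a w.
suff : eta * (v a w * d a w) <= d a w ^+ 2 + eta ^+ 2.
  by rewrite mulrC -ler_pdivlMr // mulrDl [_ / _]mulrC expr2 mulfK ?gt_eqF.
have [d0|d0] := lerP 0 (d a w).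
  apply: (@le_trans _ _ (eta * d a w)); last by nra.
  by rewrite ler_pM2l // ler_piMl.
apply: (@le_trans _ _ 0); last by rewrite addr_ge0 ?sqr_ge0.
by rewrite mulr_ge0_le0 ?mulr_ge0_le0 // ltW.
Qed.

End Average.

(** * Choice of the palette sizes *)

Section Pigeonhole.
Variables (R : realType) (delta : nat -> R) (Q : nat).
Hypothesis delta_gt0 : forall c, 0 < delta c.

(** [Num.bound] strictly exceeds its argument here, so this many increments above [delta c] would
    sum to more than 1. *)
Definition nsteps (c : nat) : nat := Num.bound (delta c)^-1.

(** A bound on [b 0 + Q] for palette sizes [b] ending at [b j = c]. *)
Fixpoint palette_bound (j c : nat) : nat :=
  if j is j'.+1 then iter (nsteps c) (palette_bound j') c else (c + Q)%N.

Lemma leq_palette_bound j c : (c <= palette_bound j c)%N.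
Proof.
elim: j c => [|j IH] c; first exact: leq_addr.
rewrite [palette_bound _ _]/(iter (nsteps c) (palette_bound j) c).
by elim: (nsteps c) => // m IHm; apply: leq_trans IHm (IH _).
Qed.

Lemma small_increment (u : nat -> R) (m : nat) (d : R) :
  0 <= u 0%N -> u m <= 1 -> 1 < d * m%:R ->
  exists2 i, (i < m)%N & u i.+1 - u i <= d.
Proof.
move=> u0 um dm.
have [/existsP[i ui]|/existsPn no] :=
  boolP [exists i : 'I_m, u i.+1 - u i <= d]; first by exists i.
suff : d * m%:R <= u m - u 0%N by lra.
rewrite -(telescope_sumr u (leq0n m)) big_mkord.
rewrite mulr_natr -[X in _ *+ X]card_ord -sumr_const; apply: ler_sum => i _.
by have := no i; rewrite -ltNge => /ltW.
Qed.

(** The sizes are chosen from the smallest outwards. Once [b j.+1 = c] is fixed, the candidates for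
    [b j] are the iterates [s i], and the pigeonhole finds a small increment of [h j] from [s i] to
    [s i.+1]. With [b j = s i], induction keeps [b 0 + Q] below [palette_bound j (s i) = s i.+1], so
    monotonicity gives the bound for level [j]. *)
Lemma plateau (h : nat -> nat -> nat -> R) (M : nat) :
  (forall i b c, 0 <= h i b c <= 1) ->
  (forall i b b' c, (b <= b' <= M)%N -> h i b c <= h i b' c) ->
  forall j c, (palette_bound j c <= M)%N ->
  exists b : nat -> nat,
    [/\ b j = c, forall i, (i < j)%N -> (b i.+1 <= b i)%N,
        (b 0%N + Q <= palette_bound j c)%N &
        forall i, (i < j)%N ->
          h i (b 0%N + Q)%N (b i.+1) - h i (b i) (b i.+1) <= delta (b i.+1)].
Proof.
move=> h01 hmono; elim=> [|j IH] c cM; first by exists (fun=> c).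
pose s i := iter i (palette_bound j) c.
have s_le i i' : (i <= i')%N -> (s i <= s i')%N.
  move=> /subnK <-; elim: (i' - i)%N => // m IHm.
  exact: leq_trans IHm (leq_palette_bound _ _).
have [i im hi] : exists2 i, (i < nsteps c)%N &
    h j (s i.+1) c - h j (s i) c <= delta c.
  apply: (@small_increment (fun i => h j (s i) c)).
  - by case/andP: (h01 j (s 0%N) c).
  - by case/andP: (h01 j (s (nsteps c)) c).
  - rewrite -[X in X < _](@mulfV _ (delta c)) ?gt_eqF // ltr_pM2l //.
    by apply: archi_boundP; rewrite invr_ge0 ltW.
have siM : (s i.+1 <= palette_bound j.+1 c)%N by apply: s_le.
have [b [bj bdec b0 hb]] := IH (s i) (leq_trans siM cM).
have bjle i' : (i' <= j)%N -> (b j <= b i')%N.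
  move=> i'j; rewrite -(subKn i'j); elim: (j - i')%N => [|m IHm].
    by rewrite subn0.
  have [mj|jm] := ltnP m j; last by rewrite (_ : j - m.+1 = j - m)%N //; lia.
  by apply: leq_trans IHm _; rewrite -(@subnSK m j) // bdec //; lia.
exists (fun i' => if i' == j.+1 then c else b i'); split.
- by rewrite eqxx.
- move=> i'; rewrite ltnS leq_eqVlt eqSS => /orP[/eqP->|lt].
    by rewrite eqxx ltn_eqF // bj; apply: (@s_le 0%N i).
  by rewrite !ltn_eqF ?bdec //; lia.
- exact: leq_trans b0 siM.
- move=> i'; rewrite ltnS leq_eqVlt eqSS => /orP[/eqP->|lt].
    rewrite eqxx (ltn_eqF (ltnSn j)) /=; apply: le_trans hi.
    rewrite bj lerB //.
    by apply: hmono; rewrite b0 (leq_trans siM cM).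
  by rewrite /= (ltn_eqF lt) (ltn_eqF (leqW lt)); exact: hb.
Qed.

End Pigeonhole.

(** * Random permutations *)

Lemma perm_of_labels (n : nat) (L : eqType) (l1 l2 : 'I_n -> L) :
  (forall x, #|[set i | l1 i == x]| = #|[set i | l2 i == x]|) ->
  exists s : 'S_n, forall i, l2 (s i) = l1 i.
Proof.
move=> ll.
have /tuple_permP[s es] : perm_eq [tuple l1 i | i < n] [tuple l2 i | i < n].
  apply/allP => x _ /=.
  have cnt (l : 'I_n -> L) :
      count_mem x [seq l i | i <- enum 'I_n] = #|[set i | l i == x]|.
    by rewrite count_map cardsE cardE size_filter -enumT; apply: eq_count.
  by rewrite !cnt ll.
exists s => i; have := congr1 (fun t : n.-tuple L => tnth t i) (val_inj es).
by rewrite !tnth_mktuple.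
Qed.

Section Permutations.
Variable n : nat.
Implicit Types (A B C S U W f : {set 'I_n}) (s p : 'S_n).

Lemma imset_permE s A B : (forall i, (s i \in B) = (i \in A)) -> s @: A = B.
Proof.
move=> sAB; apply/setP=> i; rewrite -(permKV s i) sAB mem_imset //.
exact: perm_inj.
Qed.

Lemma imset_permM s p A : (s * p)%g @: A = p @: (s @: A).
Proof. by rewrite -imset_comp; apply: eq_imset => i; rewrite /= permM. Qed.

Lemma imset_perm1 A : (1%g : 'S_n) @: A = A.
Proof. by rewrite -[RHS]imset_id; apply: eq_imset => i; rewrite perm1. Qed.

Lemma imset_permK s A : s^-1%g @: (s @: A) = A.
Proof. by rewrite -imset_permM mulgV imset_perm1. Qed.

Lemma imset_permKV s A : s @: (s^-1%g @: A) = A.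
Proof. by rewrite -imset_permM mulVg imset_perm1. Qed.

Lemma imset_perm_inj s : injective (fun A => s @: A).
Proof. by move=> A B /(congr1 (fun A => s^-1%g @: A)); rewrite !imset_permK. Qed.

Lemma imset_perm_sub s A B : (s @: A \subset s @: B) = (A \subset B).
Proof.
by apply/idP/idP => [/(imsetS s^-1%g)|/(imsetS s)//]; rewrite !imset_permK.
Qed.

Lemma card_imset_perm s A : #|s @: A| = #|A|.
Proof. by rewrite card_imset //; apply: perm_inj. Qed.

Lemma perm_flag f B C S f' B' C' S' :
  C \subset B -> [disjoint f & B] -> f :|: B \subset S ->
  C' \subset B' -> [disjoint f' & B'] -> f' :|: B' \subset S' ->
  #|f| = #|f'| -> #|B| = #|B'| -> #|C| = #|C'| -> #|S| = #|S'| ->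
  exists s, [/\ s @: f = f', s @: B = B', s @: C = C' & s @: S = S'].
Proof.
move=> CB fB fBS CB' fB' fBS' ef eB eC eS.
(* The labels 0 to 4 stand for [C], [B :\: C], [f], [S :\: (f :|: B)] and the complement of [S]. The
   four given cardinals determine the sizes of these classes, so a label-preserving permutation
   exists. *)
pose lab f0 B0 C0 S0 (i : 'I_n) : nat := (if i \in C0 then 0 else
  if i \in B0 then 1 else if i \in f0 then 2 else if i \in S0 then 3 else 4)%N.
have labE f0 B0 C0 S0 : C0 \subset B0 -> [disjoint f0 & B0] ->
    f0 :|: B0 \subset S0 ->
    [/\ [set i | lab f0 B0 C0 S0 i == 0%N] = C0,
        [set i | lab f0 B0 C0 S0 i == 1%N] = B0 :\: C0,
        [set i | lab f0 B0 C0 S0 i == 2%N] = f0,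
        [set i | lab f0 B0 C0 S0 i == 3%N] = S0 :\: (f0 :|: B0) &
        [set i | lab f0 B0 C0 S0 i == 4%N] = ~: S0].
  move=> /subsetP CB0 dfB /subsetP fBS0.
  have dis i : i \in f0 -> i \in B0 -> false.
    by move=> i_f; rewrite (disjointFr dfB i_f).
  split; apply/setP=> i; rewrite !inE /lab;
  move: (CB0 i) (dis i) (fBS0 i); rewrite !inE;
  case: (i \in C0); case: (i \in B0); case: (i \in f0); case: (i \in S0) => //=;
  by [move=> /(_ isT) | move=> _ /(_ isT isT) | move=> _ _ /(_ isT)].
have [e0 e1 e2 e3 e4] := labE _ _ _ _ CB fB fBS.
have [e0' e1' e2' e3' e4'] := labE _ _ _ _ CB' fB' fBS'.
have inE' f0 B0 C0 S0 : C0 \subset B0 -> [disjoint f0 & B0] ->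
    f0 :|: B0 \subset S0 -> forall i,
    [/\ (i \in f0) = (lab f0 B0 C0 S0 i == 2%N),
        (i \in B0) = (lab f0 B0 C0 S0 i <= 1)%N,
        (i \in C0) = (lab f0 B0 C0 S0 i == 0%N) &
        (i \in S0) = (lab f0 B0 C0 S0 i <= 3)%N].
  move=> /subsetP CB0 dfB /subsetP fBS0 i.
  move: (CB0 i) (@disjointFr _ _ _ i dfB) (fBS0 i); rewrite !inE /lab.
  case: (i \in C0) => CBi fBi fBSi.
    have iB : i \in B0 by exact: CBi.
    have iS : i \in S0 by apply: fBSi; rewrite iB orbT.
    by split=> //; apply: contraTF iB => /fBi ->.
  case: (boolP (i \in B0)) fBi fBSi => [iB fBi|iB _] fBSi.
    have iS : i \in S0 by apply: fBSi; rewrite orbT.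
    by split=> //; apply/negP => /fBi.
  by case: (i \in f0) fBSi => [-> //|_]; case: (i \in S0).
have [|s sl] := @perm_of_labels n _ (lab f B C S) (lab f' B' C' S').
  case=> [|[|[|[|[|x]]]]].
  - by rewrite e0 e0'.
  - by rewrite e1 e1' !cardsDS // eB eC.
  - by rewrite e2 e2'.
  - rewrite e3 e3' !cardsDS // !cardsU (disjoint_setI0 fB) (disjoint_setI0 fB').
    by rewrite ef eB eS.
  - by rewrite e4 e4' [LHS]cardsCs [RHS]cardsCs !setCK eS.
  - have no f0 B0 C0 S0 : [set i | lab f0 B0 C0 S0 i == x.+4.+1] = set0.
      by apply/setP=> i; rewrite !inE /lab; do 4?case: ifP.
    by rewrite !no.
exists s; split; apply: imset_permE => i;
  have [h1 h2 h3 h4] := inE' _ _ _ _ CB fB fBS i;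
  have [h1' h2' h3' h4'] := inE' _ _ _ _ CB' fB' fBS' (s i).
- by rewrite h1 h1' sl.
- by rewrite h2 h2' sl.
- by rewrite h3 h3' sl.
- by rewrite h4 h4' sl.
Qed.

Lemma perm_fixing W S S' : W \subset S -> W \subset S' -> #|S| = #|S'| ->
  exists s, (forall i, i \in W -> s i = i) /\ s @: S = S'.
Proof.
move=> WS WS' eS.
(* Each vertex of [W] is its own label, which forces [s] to fix [W] pointwise. *)
pose lab S0 (i : 'I_n) : 'I_n + bool := if i \in W then inl i else inr (i \in S0).
have [|s sl] := @perm_of_labels n _ (lab S) (lab S').
  case=> [j|[]].
  - congr #|pred_of_set _|; apply/setP=> i; rewrite !inE /lab.
    by case: ifP.
  - have e S0 : W \subset S0 -> [set i | lab S0 i == inr true] = S0 :\: W.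
      move=> WS0; apply/setP=> i; rewrite !inE /lab.
      by case: ifP => //= _; case: (i \in S0).
    by rewrite !e // !cardsDS // eS.
  - have e S0 : W \subset S0 -> [set i | lab S0 i == inr false] = ~: S0.
      move=> /subsetP WS0; apply/setP=> i; rewrite !inE /lab.
      by case: ifP => [/WS0 -> //|_]; case: (i \in S0).
    by rewrite !e // [LHS]cardsCs [RHS]cardsCs !setCK eS.
have sW i : i \in W -> s i = i.
  by move=> iW; have := sl i; rewrite /lab iW; case: ifP => // _ [].
exists s; split=> //; apply: imset_permE => i; have := sl i; rewrite /lab.
have [iW|iW] := boolP (i \in W).
  by move=> _; rewrite (sW i iW) (subsetP WS') // (subsetP WS).
by case: ifP => // _ [].
Qed.

Lemma superset_of_card W q : (#|W| <= q <= n)%N ->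
  exists S, W \subset S /\ #|S| = q.
Proof.
move=> /andP[Wq qn]; exists (W :|: [set i in take (q - #|W|) (enum (~: W))]).
split; first exact: subsetUl.
rewrite cardsU disjoint_setI0 ?cards0 ?subn0.
  rewrite cardsE (card_uniqP _) ?take_uniq ?enum_uniq // size_take -cardE.
  have := cardsC W; rewrite card_ord; case: ltnP; lia.
rewrite disjoints_subset; apply/subsetP => i iW; rewrite !inE.
by apply/negP => /mem_take; rewrite mem_enum inE iW.
Qed.

End Permutations.

(** * Images of sets under a uniform random permutation *)

Section PermutationAverages.
Variables (R : realType) (n : nat).
Implicit Types (S U : {set 'I_n}) (s p : 'S_n).

(** Right multiplication by [s] matches the fiber of [h] over [t] with the fiber over [t']; all
    fibers over [D] thus have the same size, and [h p] is uniform on [D]. *)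
Lemma avg_transitive (T : finType) (D : {set T}) (h : 'S_n -> T)
    (F : T -> R) : (forall p, h p \in D) ->
  (forall t t', t \in D -> t' \in D ->
     exists s, forall p, (h (p * s)%g == t') = (h p == t)) ->
  avg setT (fun p => F (h p)) = avg D F.
Proof.
move=> hD trans; pose k := #|[set p | h p == h 1%g]|.
have card_fib t : t \in D -> #|[set p | h p == t]| = k.
  move=> tD; have [s hs] := trans _ _ (hD 1%g) tD.
  rewrite /k -(card_preimset _ (@mulIg _ s)); congr #|pred_of_set _|.
  by apply/setP=> p; rewrite !inE hs.
have part (E : T -> R) : \sum_p E (h p) = k%:R * \sum_(t in D) E t.
  rewrite (partition_big h (mem D)) /=; last by move=> p _; apply: hD.
  rewrite mulr_sumr; apply: eq_bigr => t tD.
  rewrite -(card_fib t tD) mulr_natl -sumr_const.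
  by apply: eq_big => [p|p /eqP-> //]; rewrite inE.
have k0 : k%:R != 0 :> R.
  by rewrite pnatr_eq0 cards_eq0; apply/set0Pn; exists 1%g; rewrite inE.
have cardE : #|[set: 'S_n]|%:R = k%:R * #|D|%:R :> R.
  by rewrite -!sum1_card !natr_sum -part; apply: eq_bigl => p; rewrite inE.
rewrite /avg cardE; under eq_bigl do rewrite inE.
by rewrite part -mulf_div divff // mul1r.
Qed.

Lemma avg_imset S0 (F : {set 'I_n} -> R) :
  avg setT (fun p : 'S_n => F (p @: S0)) = avg [set S : {set 'I_n} | #|S| == #|S0|] F.
Proof.
apply: (@avg_transitive _ _ (fun p : 'S_n => p @: S0)).
  by move=> p; rewrite inE card_imset_perm.
move=> S S'; rewrite !inE => /eqP eS /eqP eS'.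
have [s [_ sS]] := @perm_fixing n set0 S S' (sub0set _) (sub0set _)
  (etrans eS (esym eS')).
by exists s => p; rewrite imset_permM -sS (inj_eq (@imset_perm_inj _ s)).
Qed.

Lemma avg_imset2 S0 U0 (F : {set 'I_n} -> {set 'I_n} -> R) : U0 \subset S0 ->
  avg setT (fun p : 'S_n => F (p @: S0) (p @: U0)) =
  avg [set X : {set 'I_n} * {set 'I_n} |
     [&& #|X.1| == #|S0|, #|X.2| == #|U0| & X.2 \subset X.1]]
    (fun X => F X.1 X.2).
Proof.
move=> US.
apply: (@avg_transitive _ _ (fun p : 'S_n => (p @: S0, p @: U0)) (fun X => F X.1 X.2)).
  by move=> p; rewrite inE /= !card_imset_perm !eqxx imset_perm_sub.
move=> [S U] [S' U']; rewrite !inE /=.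
move=> /and3P[/eqP eS /eqP eU sUS] /and3P[/eqP eS' /eqP eU' sUS'].
have [s [_ sU _ sS]] : exists s : 'S_n,
    [/\ s @: set0 = set0, s @: U = U', s @: U = U' & s @: S = S'].
  by apply: perm_flag; rewrite ?disjoints_subset ?sub0set ?set0U // ?eU ?eS.
exists s => p; rewrite !imset_permM -sS -sU !xpair_eqE.
by rewrite !(inj_eq (@imset_perm_inj _ s)).
Qed.

(** Given [p @: S0], the set [p @: U0] is uniform inside it, so a bound valid for each fixed [S]
    survives averaging. *)
Lemma avg_imset2_le S0 U0 (F : {set 'I_n} -> {set 'I_n} -> R) (a : R) :
  U0 \subset S0 ->
  (forall S, #|S| = #|S0| ->
     avg [set U : {set 'I_n} | (#|U| == #|U0|) && (U \subset S)] (F S) <= a) ->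
  avg setT (fun p : 'S_n => F (p @: S0) (p @: U0)) <= a.
Proof.
move=> US Fa; rewrite avg_imset2 //.
set D := [set X | _].
have D0 : 0 < #|D|%:R :> R.
  by rewrite ltr0n card_gt0; apply/set0Pn; exists (S0, U0); rewrite inE /= !eqxx.
pose D1 S := [set U : {set 'I_n} | (#|U| == #|U0|) && (U \subset S)].
have sumD (E : {set 'I_n} -> {set 'I_n} -> R) : \sum_(X in D) E X.1 X.2 =
    \sum_(S : {set 'I_n} | #|S| == #|S0|) \sum_(U in D1 S) E S U.
  rewrite pair_big_dep /=; apply: eq_bigl => X; rewrite !inE.
  by [].
rewrite /avg ler_pdivrMr //.
have -> : #|D|%:R = \sum_(S : {set 'I_n} | #|S| == #|S0|) (#|D1 S|%:R : R).
  rewrite -sum1_card natr_sum (sumD (fun _ _ => 1)); apply: eq_bigr => S _.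
  by rewrite -sum1_card natr_sum.
rewrite sumD mulr_sumr; apply: ler_sum => S /eqP eS.
have [e|e] := eqVneq (D1 S) set0; first by rewrite e big_set0 cards0 mulr0.
by rewrite -ler_pdivrMr ?ltr0n ?card_gt0 //; apply: Fa.
Qed.

(** Union bound over the vertices of [U0], each of which has a uniform image. *)
Lemma avg_meets U0 (P : {set 'I_n}) :
  avg setT (fun p : 'S_n => (~~ [disjoint p @: U0 & P])%:R)
    <= #|U0|%:R * (#|P|%:R / n%:R) :> R.
Proof.
have hit i : avg setT (fun p : 'S_n => (p i \in P)%:R) = #|P|%:R / n%:R :> R.
  rewrite (@avg_transitive _ [set: 'I_n] (fun p : 'S_n => p i)
    (fun j => (j \in P)%:R)) //; last first.
    move=> t t' _ _; exists (tperm t t') => p.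
    by rewrite permM -[X in _ == X](tpermL t t') (inj_eq perm_inj).
  rewrite /avg cardsT card_ord -sum1_card natr_sum big_mkcond [in RHS]big_mkcond.
  congr (_ / _); apply: eq_bigr => j _; rewrite inE.
  by case: (j \in P).
apply: (@le_trans _ _ (avg setT
    (fun p : 'S_n => \sum_(i in U0) (p i \in P)%:R))); last first.
  rewrite avg_sum; under eq_bigr do rewrite hit.
  by rewrite sumr_const -[leLHS]mulr_natl.
apply: le_avg => p _; case: (boolP [disjoint p @: U0 & P]) => [_|].
  by rewrite mulr0n sumr_ge0 // => i _; rewrite ler0n.
move=> /pred0Pn[_ /andP[/imsetP[i iU ->] /= piP]].
by rewrite (bigD1 i) //= piP lerDl sumr_ge0 // => k _; rewrite ler0n.
Qed.

End PermutationAverages.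

(** * Energy of the colors around a set *)

Section Mask.
Variables (E : finType) (T : eqType).

(** Restrictions to different [P] share one type, with [None] outside [P], so that conditioning on
    them is conditioning on an equality. *)
Definition mask (P : pred E) (x : {ffun E -> T}) : {ffun E -> option T} :=
  [ffun e => if P e then Some (x e) else None].

Lemma mask_eqP (P : pred E) (x y : {ffun E -> T}) :
  reflect (forall e, P e -> x e = y e) (mask P x == mask P y).
Proof.
apply: (iffP eqP) => [exy e Pe|exy].
  by have := congr1 (fun z : {ffun _ -> _} => z e) exy; rewrite !ffunE Pe => -[].
by apply/ffunP => e; rewrite !ffunE; case: ifP => // Pe; rewrite exy.
Qed.

Lemma mask_reindex (P P' : pred E) (x x' y y' : {ffun E -> T}) (u v : E -> E) :
  cancel v u -> (forall e, P e = P' (u e)) ->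
  (forall e, x e = x' (u e)) -> (forall e, y e = y' (u e)) ->
  (mask P x == mask P y) = (mask P' x' == mask P' y').
Proof.
move=> vK PP xx yy; apply/mask_eqP/mask_eqP => h e.
  by rewrite -[e]vK -PP -xx -yy => /h.
by rewrite PP xx yy => /h.
Qed.

End Mask.

(** Supplies the set [Zs] of [avg_resample]: the error then counts the colorings of one block
    only. *)
Lemma card_mask (E D : finType) (P : pred E) :
  exists Zs : {set {ffun E -> option D}},
    (forall y : {ffun E -> D}, mask P y \in Zs) /\
    #|Zs| = (#|D| ^ #|P|)%N.
Proof.
exists [set z | z \in pffun_on None P (predC1 None)]; split=> [y|].
  rewrite inE; apply/pffun_onP; split.
    by apply/supportP => e Pe; rewrite ffunE ifN.
  by move=> _ /imageP[e Pe ->]; rewrite !inE ffunE ifT.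
rewrite cardsE card_pffun_on; congr (_ ^ _)%N.
by rewrite cardC1 card_option.
Qed.

Definition seg (n m : nat) : {set 'I_n} := [set i : 'I_n | (i < m)%N].

Lemma card_seg n m : (m <= n)%N -> #|seg n m| = m.
Proof.
move=> mn; rewrite -[RHS]card_ord.
have wI : injective (widen_ord mn) by move=> i j [] /val_inj.
rewrite -(card_imset _ wI).
apply: eq_card => i; rewrite inE; apply/idP/imsetP.
  by move=> im; exists (Ordinal im) => //; apply: val_inj.
by move=> [j _ ->]; apply: (ltn_ord j).
Qed.

Lemma seg_sub n m m' : (m <= m')%N -> seg n m \subset seg n m'.
Proof. by move=> mm; apply/subsetP => i; rewrite !inE => /leq_trans ->. Qed.

Section LinkEnergy.
Variables (R : realType) (C D : finType) (n q : nat).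
Variables (G : {set 'I_n} -> C) (H : {set 'I_n} -> {set 'I_n} -> D).
Notation E := {set 'I_n}.
Implicit Types (e f B A S U : E) (s p : 'S_n).

(** Both colorings are read back along [p]: the random sample is [p @: S], but it is described on
    the fixed set [S]. *)
Definition base p : {ffun E -> C} := [ffun e : E => G (p @: e)].
Definition sample S p : {ffun E -> D} := [ffun e : E => H (p @: S) (p @: e)].

Lemma base_mul s p e : base (s * p) e = base p (s @: e).
Proof. by rewrite !ffunE imset_permM. Qed.

Lemma sample_mul S s p e : sample S (s * p) e = sample (s @: S) p (s @: e).
Proof. by rewrite !ffunE !imset_permM. Qed.

(** Colors are given to all sets of vertices, of any size; [link] records those of
    [f :|: B] for all [B \subset A], and [link_context] what is visible on
    [f :|: B] when the colors of all sets containing [f] are hidden. *)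
Definition link_context f B S p :=
  (mask [pred e : E | e \subset f :|: B] (base p),
   mask [pred e : E | (e \subset f :|: B) && ~~ (f \subset e)] (sample S p)).

Definition link f A S p :=
  mask [pred e : E | (f \subset e) && (e \subset f :|: A)] (sample S p).

Definition link_energy f B A S : R := energy R (link_context f B S) (link f A S).

(** Left multiplication by [s] is a bijection of the probability space, and the data of [f], [B],
    [A], [S] at [s * p] are those of their images at [p]. *)
Lemma link_energy_perm s f B A S :
  link_energy (s @: f) (s @: B) (s @: A) (s @: S) = link_energy f B A S.
Proof.
have bij : bijective (fun p : 'S_n => s * p)%g.
  by exists (fun p => s^-1 * p)%g => p; rewrite ?mulKg ?mulKVg.
rewrite /link_energy -[RHS](energy_reindex _ _ _ bij).
apply: eq_energy => p p'; rewrite ?xpair_eqE.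
  congr (_ && _); apply/esym.
    apply: mask_reindex (imset_permKV s) _ (base_mul _ _) (base_mul _ _) => e.
    by rewrite /= -imsetU imset_perm_sub.
  apply: mask_reindex (imset_permKV s) _ (sample_mul _ _ _) (sample_mul _ _ _).
  by move=> e; rewrite /= -imsetU !imset_perm_sub.
apply/esym.
apply: mask_reindex (imset_permKV s) _ (sample_mul _ _ _) (sample_mul _ _ _).
by move=> e; rewrite /= -imsetU !imset_perm_sub.
Qed.

Lemma le_link_energy f B B' A S : B \subset B' ->
  link_energy f B A S <= link_energy f B' A S.
Proof.
move=> BB'; apply: le_energy => p p' /eqP; rewrite xpair_eqE => /andP[].
have sub e : e \subset f :|: B -> e \subset f :|: B'.
  by move=> /subset_trans; apply; apply: setUS.
move=> /mask_eqP hb /mask_eqP hs; apply/eqP; rewrite xpair_eqE.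
apply/andP; split; apply/mask_eqP => e /=; first by move=> /sub/hb.
by move=> /andP[/sub se fe]; apply: hs; rewrite /= se.
Qed.

(** A reference position: [f] consists of the last [j] of the first [q] vertices, which keeps it
    disjoint from [seg n b] when [j + b <= q]. *)
Definition std_energy (j b a : nat) : R :=
  link_energy (seg n q :\: seg n (q - j)) (seg n b) (seg n a) (seg n q).

Lemma std_energy_mono j b b' a : (b <= b')%N ->
  std_energy j b a <= std_energy j b' a.
Proof. by move=> bb; apply/le_link_energy/seg_sub. Qed.

Lemma link_energyE f B A S : (q <= n)%N -> A \subset B -> [disjoint f & B] ->
  f :|: B \subset S -> #|S| = q ->
  link_energy f B A S = std_energy #|f| #|B| #|A|.
Proof.
move=> qn AB fB fBS Sq.
have fBq : (#|f| + #|B| <= q)%N.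
  by rewrite -Sq -cardsUI (disjoint_setI0 fB) cards0 addn0 subset_leq_card.
have Bn : (#|B| <= n)%N by lia.
have An : (#|A| <= n)%N by apply: leq_trans (subset_leq_card AB) Bn.
have [s [ef eB eA eS]] : exists s, [/\ s @: f = seg n q :\: seg n (q - #|f|),
    s @: B = seg n #|B|, s @: A = seg n #|A| & s @: S = seg n q].
  apply: perm_flag => //; rewrite ?card_seg //; last 1 first.
  - rewrite cardsDS ?seg_sub ?leq_subr // !card_seg //; lia.
  - exact/seg_sub/subset_leq_card.
  - rewrite disjoints_subset; apply/subsetP => i; rewrite !inE; lia.
  - apply/subsetP => i; rewrite !inE; lia.
by rewrite /std_energy -ef -eB -eA -eS link_energy_perm.
Qed.

End LinkEnergy.

(** * Resampling the colors *)

Section Resampling.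
Variables (R : realType) (C D : finType) (n q r : nat).
Variables (G : {set 'I_n} -> C) (H : {set 'I_n} -> {set 'I_n} -> D).
Variable b : nat -> nat.
Notation E := {set 'I_n}.
Notation base := (base G).
Notation sample := (sample H).
Implicit Types (e f g B A S U : E) (s p : 'S_n).
Implicit Types (x : {ffun E -> C}) (y : {ffun E -> D}).
Implicit Types (phi : {ffun E -> D} -> R) (L : seq E).
Implicit Types psi : {ffun E -> C} -> {ffun E -> D} -> R.

Let P := seg n (b 0%N).

(** A set [e] is colored when [f = e :\: P] is processed, provided that its
    palette part lies in the palette of level [#|f| + 1]. *)
Definition visible e := e :&: P \subset seg n (b #|e :\: P|.+1).

Definition block f : pred E := [pred e : E | (e :\: P == f) && visible e].

Definition view f x y :=
  (mask [pred e : E | e \subset P :|: f] x,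
   mask [pred e : E | (e :\: P \proper f) && visible e] y).

Definition paste f y' y : {ffun E -> D} :=
  [ffun e : E => if block f e then y' e else y e].

Definition matches f S x y : {set 'S_n} :=
  [set p | view f (base p) (sample S p) == view f x y].

(** When nothing matches, the fallback keeps the total mass equal to 1 and does
    not look at the colors on [block f]. *)
Definition pool f S x y : {set 'S_n} :=
  if matches f S x y == set0 then setT else matches f S x y.

(** A Markov operator acting on test functions: randomness enters only through averages over
    permutations. *)
Definition resample f S x phi y : R :=
  avg (pool f S x y) (fun p => phi (paste f (sample S p) y)).

Lemma pool_neq0 f S x y : pool f S x y != set0.
Proof.
by rewrite /pool; case: ifPn => // _; apply/set0Pn; exists 1%g; rewrite inE.
Qed.

(** Operators compose backwards: the outermost one, for the head of [L], redraws its block first. *)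
Definition resample_all (Sf : E -> E) x L phi : {ffun E -> D} -> R :=
  foldr (fun f => resample f (Sf f) x) phi L.

Lemma eq_resample f S x phi phi' y :
  (forall y', phi y' = phi' y') -> resample f S x phi y = resample f S x phi' y.
Proof.
by move=> e; apply: eq_avg.
Qed.

Lemma resample_bounds f S x phi y (l m : R) :
  (forall y', l <= phi y' <= m) -> l <= resample f S x phi y <= m.
Proof.
move=> lm; rewrite /resample.
rewrite -{1}(avg_const l (pool_neq0 f S x y)) -(avg_const m (pool_neq0 f S x y)).
by rewrite !le_avg // => p _; case/andP: (lm (paste f (sample S p) y)).
Qed.

Lemma resample_all_bounds Sf x L phi y (l m : R) :
  (forall y', l <= phi y' <= m) -> l <= resample_all Sf x L phi y <= m.
Proof. by move=> lm; elim: L y => //= f L IH y; apply: resample_bounds. Qed.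

Lemma resample_sum (I : finType) (Q : pred I) f S x (phi : I -> _) y :
  resample f S x (fun y' => \sum_(i | Q i) phi i y') y =
  \sum_(i | Q i) resample f S x (phi i) y.
Proof. exact: avg_sum. Qed.

Lemma resample_all_sum (I : finType) (Q : pred I) Sf x L (phi : I -> _) y :
  resample_all Sf x L (fun y' => \sum_(i | Q i) phi i y') y =
  \sum_(i | Q i) resample_all Sf x L (phi i) y.
Proof.
elim: L y => //= f L IH y.
by rewrite (eq_resample _ _ _ _ IH) resample_sum.
Qed.

Lemma block_sub f e : block f e -> e \subset P :|: f.
Proof.
move=> /andP[/eqP <- _]; rewrite -{1}(setID e P).
by rewrite setSU // subsetIr.
Qed.

Lemma inner_sub f e : e :\: P \proper f -> e \subset P :|: f.
Proof.
move=> /proper_sub sub; rewrite -(setID e P); apply: setUSS => //.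
exact: subsetIr.
Qed.

(** A permutation that fixes [P :|: f] pointwise and carries [S] to [S'] preserves all that the step
    reads or writes. The procedure can therefore use one set [Sf f] for each [f], while the analysis
    uses a common [S]. *)
Lemma resample_indep f S S' x phi y : #|S| = #|S'| ->
  P :|: f \subset S -> P :|: f \subset S' ->
  resample f S x phi y = resample f S' x phi y.
Proof.
move=> eS PS PS'; have [s [sP sS]] := perm_fixing PS PS' eS.
have fix_e e : e \subset P :|: f -> s @: e = e.
  move=> /subsetP sub; rewrite -[RHS]imset_id; apply: eq_in_imset => i /sub.
  exact: sP.
have bij : bijective (fun p : 'S_n => s * p)%g.
  by exists (fun p => s^-1 * p)%g => p; rewrite ?mulKg ?mulKVg.
have sam p e : e \subset P :|: f -> sample S (s * p) e = sample S' p e.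
  by move=> sub; rewrite sample_mul sS fix_e.
have ME : matches f S' x y = (fun p => s * p)%g @^-1: matches f S x y.
  apply/setP=> p; rewrite !inE; congr (_ == _); rewrite /view.
  congr pair; apply/eqP/mask_eqP => e /=.
    by move=> sub; rewrite base_mul fix_e.
  by move=> /andP[/inner_sub sub _]; rewrite sam.
have pasteE p : paste f (sample S (s * p)) y = paste f (sample S' p) y.
  by apply/ffunP=> e; rewrite ffunE [RHS]ffunE; case: ifP => // /block_sub; apply: sam.
have poolE : pool f S' x y = (fun p => s * p)%g @^-1: pool f S x y.
  rewrite /pool ME; set M := matches f S x y.
  have -> : ((fun p => s * p)%g @^-1: M == set0) = (M == set0).
    by rewrite -!cards_eq0 on_card_preimset //; apply: onW_bij.
  by case: ifP => // _; rewrite preimsetT.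
rewrite /resample -[LHS](avg_preimset _ _ bij) -poolE.
by apply: eq_avg => p _; rewrite pasteE.
Qed.

Definition in_blocks U e := [&& e :\: P \subset U, (#|e :\: P| <= r)%N & visible e].

Definition agree U L x x' y y' :=
  (forall e, e \subset P :|: U -> x e = x' e) /\
  (forall e, in_blocks U e -> e :\: P \notin L -> y e = y' e).

(** The sets [L] that remain to be processed: no proper subset of a member comes
    after it, and all proper supersets do. *)
Definition terminal U L := [/\ sorted (fun f g : E => (#|f| <= #|g|)%N) L, uniq L,
  forall f, f \in L -> (f \subset U) && (#|f| <= r)%N &
  forall f g, f \in L -> f \proper g -> g \subset U -> (#|g| <= r)%N -> g \in L].

Lemma terminal_tail U f L : terminal U (f :: L) -> terminal U L.
Proof.
move=> [sL uL subL upL]; split.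
- exact: path_sorted sL.
- by case/andP: uL.
- by move=> g gL; apply: subL; rewrite inE gL orbT.
- move=> g g' gL gg' g'U g'r.
  have /[!inE] /orP[/eqP e|//] : g' \in f :: L.
    by apply: upL gg' g'U g'r; rewrite inE gL orbT.
  have := order_path_min _ sL; rewrite -e => /(_ (fun a b c => @leq_trans _ _ _)).
  move=> /allP/(_ _ gL); rewrite leqNgt.
  by rewrite (proper_card gg').
Qed.

Lemma terminal_inner U f L g : terminal U (f :: L) -> g \proper f ->
  g \notin f :: L.
Proof.
move=> [sL _ _ _] gf; rewrite inE negb_or (proper_neq gf) /=.
apply/negP=> gL; have := proper_card gf; rewrite ltnNge => /negP[].
have := order_path_min _ sL => /(_ (fun a b c => @leq_trans _ _ _)).
by move=> /allP/(_ _ gL).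
Qed.

(** Processing [f] reads [x] inside [P :|: f] and the blocks of proper subsets of [f], which by
    [terminal] are no longer waiting in [L], and it overwrites its own block. The initial colors on
    the blocks of [L] are thus forgotten. *)
Lemma resample_all_agree U L Sf psi :
  (forall x x' y y', agree U [::] x x' y y' -> psi x y = psi x' y') ->
  terminal U L -> forall x x' y y', agree U L x x' y y' ->
  resample_all Sf x L (psi x) y = resample_all Sf x' L (psi x') y'.
Proof.
move=> psi_ag; elim: L => [_|f L IH tL] x x' y y' ag; first exact: psi_ag.
have [_ _ subL _] := tL; have /andP[fU fr] := subL f (mem_head _ _).
have [xx yy] := ag.
have MM : matches f (Sf f) x y = matches f (Sf f) x' y'.
  apply/setP=> p; rewrite !inE; congr (_ == _); congr pair.
    apply/eqP/mask_eqP => e /= sub; apply: xx.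
    exact: subset_trans sub (setUS _ fU).
  apply/eqP/mask_eqP => e /= /andP[ef ve].
  apply: yy; last exact: terminal_inner tL ef.
  rewrite /in_blocks ve (subset_trans (proper_sub ef) fU) andbT /=.
  by apply: leq_trans fr; rewrite ltnW // proper_card.
have IHp y1 y1' : (forall e, in_blocks U e -> e :\: P \notin L -> y1 e = y1' e) ->
   resample_all Sf x L (psi x) y1 = resample_all Sf x' L (psi x') y1'.
  by move=> h; apply: IH (terminal_tail tL) _ _ _ _ _.
rewrite /= /resample /pool MM.
apply: eq_avg => p _; apply: IHp => e be eL; rewrite !ffunE; case: ifPn => // nb.
apply: yy => //; rewrite inE negb_or eL andbT; apply: contra nb => /eqP ef.
by rewrite /block /= ef eqxx; case/and3P: be.
Qed.

(** A step at some [f] not inside [U] writes only to sets [e] with [e :\: P = f], which neither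
    [phi] nor the steps inside [U] read. This leaves at most [2 ^ #|U|] steps, whatever [n] is. *)
Lemma resample_all_filter U Sf x L phi y :
  (forall y1 y2, (forall e, e :\: P \subset U -> y1 e = y2 e) -> phi y1 = phi y2) ->
  resample_all Sf x L phi y =
  resample_all Sf x [seq f : E <- L | f \subset U] phi y.
Proof.
move=> phiU; elim: L y => //= f L IH y.
rewrite (eq_resample _ _ _ _ IH).
have {IH} : forall y1 y2, (forall e, e :\: P \subset U -> y1 e = y2 e) ->
    resample_all Sf x [seq f : E <- L | f \subset U] phi y1 =
    resample_all Sf x [seq f : E <- L | f \subset U] phi y2.
  elim: L {IH} => [|g L IH] y1 y2 y12 /=; first exact: phiU.
  case: ifP => gU; last exact: IH.
  rewrite /= /resample; have -> : pool g (Sf g) x y1 = pool g (Sf g) x y2.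
    rewrite /pool (_ : matches g (Sf g) x y1 = matches g (Sf g) x y2) //.
    apply/setP=> p; rewrite !inE; congr (_ == _); congr pair.
    apply/eqP/mask_eqP => e /= /andP[/proper_sub eg _].
    by apply: y12; apply: subset_trans eg gU.
  apply: eq_avg => p _; apply: IH => e eU.
  by rewrite ffunE [RHS]ffunE; case: ifP => // _; apply: y12.
case: ifP => [//|/negbT fU].
move: (resample_all _ _ _ _) => phi' phi'U; rewrite /resample.
rewrite -[RHS](avg_const _ (pool_neq0 f (Sf f) x y)); apply: eq_avg => p _.
apply: phi'U => e eU; rewrite ffunE; case: ifP => // /andP[/eqP ef _].
by move: fU; rewrite -ef eU.
Qed.

Definition schedule : seq E :=
  sort (fun f g : E => (#|f| <= #|g|)%N)
    [seq f : E <- enum {: E} | [disjoint f & P] && (#|f| <= r)%N].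

Lemma mem_schedule f : f \in schedule = [disjoint f & P] && (#|f| <= r)%N.
Proof. by rewrite mem_sort mem_filter mem_enum andbT. Qed.

Lemma terminal_schedule U : [disjoint U & P] ->
  terminal U [seq f : E <- schedule | f \subset U].
Proof.
move=> UP; split.
- apply: sorted_filter; first by move=> ? ? ?; apply: leq_trans.
  by apply: sort_sorted => f g; apply: leq_total.
- by rewrite filter_uniq // sort_uniq filter_uniq // enum_uniq.
- by move=> f; rewrite mem_filter mem_schedule => /and3P[-> _ ->].
- move=> f g _ _ gU gr; rewrite mem_filter gU mem_schedule gr andbT /=.
  exact: disjointWl gU UP.
Qed.

Lemma size_schedule U :
  (size [seq f : E <- schedule | f \subset U] <= 2 ^ #|U|)%N.
Proof.
rewrite -card_powerset cardE; apply: uniq_leq_size.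
  by rewrite filter_uniq // sort_uniq filter_uniq // enum_uniq.
by move=> f; rewrite mem_filter mem_enum powersetE => /andP[].
Qed.

Variables (Q : nat) (delta : nat -> R) (eps : R).
Hypothesis eps_gt0 : 0 < eps.
Hypothesis deltaE : forall c, delta c = eps ^+ 2 / (4 * (#|D| ^ (2 ^ c))%:R).
Hypothesis q_le_n : (q <= n)%N.
Hypothesis b0_le_q : (b 0%N + Q <= q)%N.
Hypothesis b_dec : forall j, (j <= r)%N -> (b j.+1 <= b j)%N.
Hypothesis b_plateau : forall j, (j <= r)%N ->
  std_energy R q G H j (b 0%N + Q)%N (b j.+1) -
  std_energy R q G H j (b j) (b j.+1) <= delta (b j.+1).

Lemma palette_mono i j : (i <= j <= r.+1)%N -> (b j <= b i)%N.
Proof.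
move=> /andP[/subnK <-]; elim: (j - i)%N => [|m IH] // mr.
by rewrite addSn; apply: leq_trans (b_dec _) (IH _); lia.
Qed.

Lemma card_palette j : (j <= r.+1)%N -> #|seg n (b j)| = b j.
Proof.
move=> jr; apply: card_seg; have : (b j <= b 0%N)%N by apply: palette_mono.
lia.
Qed.

Lemma block_link f e : [disjoint f & P] -> (#|f| <= r)%N ->
  block f e = (f \subset e) && (e \subset f :|: seg n (b #|f|.+1)).
Proof.
move=> fP fr; have AP : seg n (b #|f|.+1) \subset P.
  by apply: seg_sub; apply: palette_mono.
apply/andP/andP => [[/eqP ef]|[fe /subsetP ef]].
  rewrite /visible ef => ve; split; first by rewrite -ef subsetDl.
  by rewrite -{1}(setID e P) ef setUC setUS.
have eE : e :\: P = f.
  apply/setP=> i; rewrite inE; apply/andP/idP => [[iP /ef]|i_f].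
    by rewrite inE => /orP[//|/(subsetP AP)]; rewrite (negPf iP).
  by rewrite (disjointFr fP i_f) (subsetP fe).
split; first by rewrite /= eE.
rewrite /visible eE; apply/subsetP => i; rewrite inE => /andP[/ef].
by rewrite inE => /orP[i_f|//]; rewrite (disjointFr fP i_f).
Qed.

(** On a block, [e :&: P] determines [e] and lies in a palette of size [b #|f|.+1]. *)
Lemma card_block f : [disjoint f & P] -> (#|f| <= r)%N ->
  (#|[pred e | block f e]| <= 2 ^ b #|f|.+1)%N.
Proof.
move=> fP fr; rewrite -(@card_palette #|f|.+1) ?ltnS // -card_powerset.
rewrite -(cardsE (block f)).
have inj : {in [set e | block f e] &, injective (fun e : E => e :&: P)}.
  move=> e e'; rewrite !inE => /andP[/eqP ef _] /andP[/eqP ef' _] ee.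
  by rewrite -(setID e P) -(setID e' P) ee ef ef'.
rewrite -(card_in_imset inj); apply/subset_leq_card/subsetP => A /imsetP[e].
by rewrite inE => /andP[/eqP <- ve] ->; rewrite powersetE.
Qed.

(** * The cost of resampling, block by block *)

Section Step.
Variables (U S : E) (Sf : E -> E) (psi : {ffun E -> C} -> {ffun E -> D} -> R).
Hypothesis U_P : [disjoint U & P].
Hypothesis PU_S : P :|: U \subset S.
Hypothesis card_S : #|S| = q.
Hypothesis card_U : (#|U| <= Q)%N.
Hypothesis Sf_P : forall f, f \subset U -> (#|f| <= r)%N ->
  P :|: f \subset Sf f /\ #|Sf f| = q.
Hypothesis psi_agree : forall x x' y y', agree U [::] x x' y y' ->
  psi x y = psi x' y'.
Hypothesis psi01 : forall x y, 0 <= psi x y <= 1.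

(** A hybrid: the blocks of [L] are resampled and the other colors come from the true sample, so an
    empty [L] gives the sample itself. *)
Let run L p := resample_all Sf (base p) L (psi (base p)) (sample S p).

(** A set [e] inside [f :|: seg n (b #|f|)] that does not contain [f] has [e :\: P] properly inside
    [f]. It is visible because [#|e :\: P|.+1 <= #|f|] and the palettes decrease. So [view] refines
    the link context with palette size [b #|f|]. *)
Lemma context_energy_ge f : f \subset U -> (#|f| <= r)%N ->
  std_energy R q G H #|f| (b #|f|) (b #|f|.+1) <=
  energy R (fun p => view f (base p) (sample S p))
           (fun p => mask (block f) (sample S p)).
Proof.
move=> fU fr; have fP : [disjoint f & P] by apply: disjointWl U_P.
have bP : seg n (b #|f|) \subset P by apply/seg_sub/palette_mono; lia.
rewrite -[X in std_energy _ _ _ _ _ X _](card_palette (leqW fr)).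
rewrite -[X in std_energy _ _ _ _ _ _ X](@card_palette #|f|.+1) //.
rewrite -(@link_energyE _ _ _ _ _ _ _ f _ _ S) //; first last.
- apply: subset_trans PU_S; rewrite setUC; exact: setUSS.
- by apply: disjointWr fP.
- exact/seg_sub/b_dec.
rewrite /link_energy (@eq_energy _ _ _ _ _ _
  (link_context G H f (seg n (b #|f|)) S)
  (link_context G H f (seg n (b #|f|)) S) _
  (fun p => mask (block f) (sample S p))) //; last first.
  move=> p p'; apply/mask_eqP/mask_eqP => h e /=.
    by rewrite block_link // => /h.
  by rewrite -block_link // => /h.
apply: le_energy => p p' /eqP; rewrite xpair_eqE => /andP[/mask_eqP hx /mask_eqP hy].
apply/eqP; rewrite xpair_eqE; apply/andP; split; apply/mask_eqP => e /=.
  by move=> ef; apply: hx; rewrite /= setUC; apply: subset_trans ef (setUS _ _).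
move=> /andP[ef fe]; apply: hy => /=.
have sub : e :\: P \proper f.
  rewrite properE; apply/andP; split.
    apply/subsetP => i; rewrite inE => /andP[iP /(subsetP ef)].
    by rewrite inE => /orP[//|/(subsetP bP)]; rewrite (negPf iP).
  apply: contra fe => fe; apply: subset_trans fe (subsetDl _ _).
rewrite sub /= /visible; apply/subsetP => i; rewrite inE => /andP[/(subsetP ef)].
rewrite inE => /orP[i_f|]; first by rewrite (disjointFr fP i_f).
move=> ib _; apply: (subsetP (seg_sub _ (palette_mono _))) ib.
by rewrite proper_card //= ltnW.
Qed.

(** For [B = P :|: (U :\: f)] one has [f :|: B = P :|: U]. No block of the history contains [f],
    because [terminal] keeps [f] and its supersets inside [U] of size at most [r] in [f :: L]. The
    history is thus coarser than the link context of [B]. *)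
Lemma history_energy_le f L : terminal U (f :: L) ->
  energy R (fun p => (mask [pred e : E | e \subset P :|: U] (base p),
      mask [pred e : E | in_blocks U e && (e :\: P \notin f :: L)] (sample S p)))
    (fun p => mask (block f) (sample S p)) <=
  std_energy R q G H #|f| (b 0%N + Q)%N (b #|f|.+1).
Proof.
move=> tL; have [_ _ subL upL] := tL.
have /andP[fU fr] := subL f (mem_head _ _).
have fP : [disjoint f & P] by apply: disjointWl U_P.
pose B := P :|: (U :\: f).
have fB : f :|: B = P :|: U by rewrite setUCA -{1}(setIidPr fU) setID.
have cB : (#|B| <= b 0%N + Q)%N.
  apply: leq_trans (leq_card_setU _ _) _; rewrite card_palette //.
  by rewrite leq_add2l (leq_trans _ card_U) // subset_leq_card // subsetDl.
apply: le_trans (std_energy_mono _ _ _ _ _ _ cB).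
rewrite -[X in std_energy _ _ _ _ _ _ X](@card_palette #|f|.+1) //.
rewrite -(@link_energyE _ _ _ _ _ _ _ f _ _ S) //; first last.
- by rewrite fB.
- rewrite disjoints_subset setCU subsetI -!disjoints_subset fP /=.
  by rewrite disjoints_subset; apply/subsetP => i i_f; rewrite !inE i_f.
- by apply: subset_trans (subsetUl _ _); apply/seg_sub/palette_mono.
rewrite /link_energy [leRHS](@eq_energy _ _ _ _ _ _ _
  (link_context G H f B S) _
  (fun p => mask (block f) (sample S p))) //; last first.
  move=> p p'; apply/mask_eqP/mask_eqP => h e /=.
    by rewrite block_link // => /h.
  by rewrite -block_link // => /h.
apply: le_energy => p p' /eqP; rewrite xpair_eqE => /andP[/mask_eqP hx /mask_eqP hy].
apply/eqP; rewrite xpair_eqE; apply/andP; split; apply/mask_eqP => e /=.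
  by move=> ef; apply: hx; rewrite /= fB.
move=> /andP[/and3P[eU er ve] eL]; apply: hy => /=; rewrite fB; apply/andP; split.
  rewrite -(setID e P); apply: setUSS => //; exact: subsetIr.
apply: contra eL => fe; have {}fe : f \subset e :\: P.
  by rewrite subsetD fe.
rewrite inE; have [->|nef] := eqVneq (e :\: P) f; first by [].
have := upL f (e :\: P) (mem_head _ _).
rewrite properEneq eq_sym nef fe => /(_ isT eU er).
by rewrite inE (negPf nef).
Qed.

(** Conditioning on the whole history is compared with conditioning on [view]:
    both lie between the contexts with palettes of sizes [b #|f|] and [b 0 + Q],
    whose energies are close. *)
Lemma resample_step f L : terminal U (f :: L) ->
  avg setT (run L) <= avg setT (run (f :: L)) + eps.
Proof.
move=> tL; have [_ _ subL upL] := tL.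
have /andP[fU fr] := subL f (mem_head _ _).
have fP : [disjoint f & P] by apply: disjointWl U_P.
(* For [a = z p], [paste f] reads [unmask a] only where the mask holds a color; [d0] serves the
   other values of [a]. *)
pose d0 := H set0 set0.
pose unmask (a : {ffun E -> option D}) : {ffun E -> D} :=
  [ffun e => odflt d0 (a e)].
pose v a p := resample_all Sf (base p) L (psi (base p))
  (paste f (unmask a) (sample S p)).
pose h p := (mask [pred e : E | e \subset P :|: U] (base p),
  mask [pred e : E | in_blocks U e && (e :\: P \notin f :: L)] (sample S p)).
pose c p := view f (base p) (sample S p).
pose z p := mask (block f) (sample S p).
have [Zs [zZs cZs]] := card_mask D (block f).
have D0 : (0 < #|D|)%N by apply/card_gt0P; exists d0.
pose N : R := (#|D| ^ (2 ^ b #|f|.+1))%:R.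
have N0 : 0 < N by rewrite ltr0n expn_gt0 D0.
have ZN : #|Zs|%:R <= N.
  by rewrite ler_nat cZs leq_pexp2l //; apply: card_block.
(* This balances the two errors of [avg_resample]: [N * eta = eps / 2], and the plateau bound
   [eps ^+ 2 / (4 * N)] equals [eps / 2 * eta]. *)
pose eta := eps / (2 * N).
have eta0 : 0 < eta by rewrite divr_gt0 // mulr_gt0.
have paste_z p p' : paste f (unmask (z p)) (sample S p') =
    paste f (sample S p) (sample S p').
  by apply/ffunP => e; rewrite ffunE [RHS]ffunE; case: ifP => // fe;
    rewrite !ffunE fe.
have hc : refines h c.
  move=> p p' /eqP; rewrite xpair_eqE => /andP[/mask_eqP hx /mask_eqP hy].
  apply/eqP; rewrite xpair_eqE; apply/andP; split; apply/mask_eqP => e /=.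
    by move=> ef; apply: hx; apply: subset_trans ef (setUS _ fU).
  move=> /andP[ef ve]; apply: hy => /=.
  rewrite (terminal_inner tL ef) andbT /in_blocks ve andbT.
  rewrite (subset_trans (proper_sub ef) fU) /=.
  by apply: leq_trans fr; rewrite ltnW // proper_card.
have hv a : refines h (v a).
  move=> p p' /eqP; rewrite xpair_eqE => /andP[/mask_eqP hx /mask_eqP hy].
  rewrite /v; apply: (resample_all_agree _ psi_agree (terminal_tail tL)).
  split=> [//|e ie eL].
  rewrite ffunE [RHS]ffunE; case: ifPn => // nb; apply: hy.
  rewrite /= ie inE negb_or eL andbT /=; apply: contra nb => ef.
  by rewrite /block /= ef; case/and3P: ie.
have v01 a p : 0 <= v a p <= 1 by apply: resample_all_bounds.
have W0 : (0 < #|{: 'S_n}|)%N by apply/card_gt0P; exists 1%g.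
have := avg_resample eta0 W0 hc (fun p => zZs (sample S p)) v01 hv.
have -> : avg setT (fun p => v (z p) p) = avg setT (run L).
  apply: eq_avg => p _; rewrite /v paste_z; congr (resample_all _ _ _ _ _).
  by apply/ffunP => e; rewrite ffunE; case: ifP.
have -> : avg setT (fun p => cexp c (fun p' => v (z p') p) p) =
    avg setT (run (f :: L)).
  apply: eq_avg => p _; have [PSf cSf] := Sf_P fU fr.
  rewrite /run /= (@resample_indep _ _ S) ?cSf ?card_S //; last first.
    by apply: subset_trans PU_S; apply: setUS.
  (* Each [p] matches its own view, so the fallback of [pool] is not reached. *)
  have mE : matches f S (base p) (sample S p) = fiber c p.
    by apply/setP=> p'; rewrite !inE.
  rewrite /resample /pool mE (negPf (fiber_neq0 c p)); apply: eq_avg => p' _.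
  by rewrite /v paste_z.
move=> /le_trans; apply; rewrite -addrA lerD2l.
have dE : energy R h z - energy R c z <= eps ^+ 2 / (4 * N).
  rewrite -deltaE; apply: le_trans (b_plateau fr).
  by apply: lerB; [apply: history_energy_le | apply: context_energy_ge].
have : (energy R h z - energy R c z) / eta <= eps / 2.
  rewrite ler_pdivrMr //; apply: le_trans dE _.
  rewrite /eta le_eqVlt; apply/orP; left; apply/eqP; field.
  by rewrite gt_eqF.
have : #|Zs|%:R * eta <= eps / 2.
  apply: le_trans (ler_wpM2r (ltW eta0) ZN) _.
  rewrite /eta le_eqVlt; apply/orP; left; apply/eqP; field.
  by rewrite gt_eqF.
lra.
Qed.

Lemma resample_all_ge L : terminal U L ->
  avg setT (fun p => psi (base p) (sample S p)) <=
  avg setT (run L) + (size L)%:R * eps.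
Proof.
elim: L => [_|f L IH tL]; first by rewrite mul0r addr0.
have := resample_step tL; have := IH (terminal_tail tL).
rewrite [size (_ :: _)]/= -natr1 mulrDl mul1r; lra.
Qed.

End Step.

End Resampling.

(** * Transfer of colorings from samples *)

Section Transfer.
Variables (R : realType) (D : finType) (Q r : nat) (eps : R).
Hypothesis D_gt0 : (0 < #|D|)%N.
Hypothesis eps_gt0 : 0 < eps.

(** Half of [eps] pays for the at most [2 ^ Q] steps that concern one [Q]-set, the other half for
    the [Q]-sets that meet the palette. *)
Let step_eps : R := eps / 2 / (2 ^ Q)%:R.
Let delta (c : nat) : R := step_eps ^+ 2 / (4 * (#|D| ^ (2 ^ c))%:R).
Let max_palette : nat := palette_bound delta Q r.+1 0.

(** The first term leaves room for [P :|: f] and [P :|: U] inside a [q]-set; the second makes the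
    chance that a random [Q]-set meets [P] at most [eps / 2]. *)
Definition transfer_size : nat :=
  maxn (max_palette + r + Q) (Num.bound ((Q * max_palette)%:R / (eps / 2))).

Lemma leq_transfer_size : (Q <= transfer_size)%N.
Proof. by apply: leq_trans (leq_maxl _ _); apply: leq_addl. Qed.

Lemma step_eps_gt0 : 0 < step_eps.
Proof. by rewrite !divr_gt0 // ltr0n expn_gt0. Qed.

Lemma delta_gt0 c : 0 < delta c.
Proof.
by rewrite divr_gt0 ?exprn_gt0 ?step_eps_gt0 // mulr_gt0 // ltr0n expn_gt0 D_gt0.
Qed.

Variables (C : finType) (n : nat).
Notation E := {set 'I_n}.
Notation q := transfer_size.
Variables (G : {ffun E -> C}) (H : E -> {ffun E -> D}).
Variable tau : E -> {ffun E -> C} -> {ffun E -> D} -> bool.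
Hypothesis q_le_n : (q <= n)%N.
Hypothesis tau_local : forall (U : E) (x x' : {ffun E -> C}) (y y' : {ffun E -> D}),
  (forall e : E, e \subset U -> (#|e| <= r)%N -> x e = x' e /\ y e = y' e) ->
  tau U x y = tau U x' y'.
Hypothesis tau_inv : forall (p : 'S_n) (U : E) (x : {ffun E -> C}) (y : {ffun E -> D}),
  tau (p @: U) x y =
  tau U [ffun e : E => x (p @: e)] [ffun e : E => y (p @: e)].

(** For each [Q]-set [U] disjoint from [P], the resampled coloring passes the test almost as often
    as the true sample. Some pair of a permutation and a coloring passes for at least the average
    number of such [U]; undoing its permutation gives the coloring of [G]. *)
Lemma transfer : exists y : {ffun E -> D}, forall S U : E,
  U \subset S -> #|S| = q -> #|U| = Q ->
  avg setT (fun p : 'S_n => (tau (p @: U) G (H (p @: S)))%:R) <=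
  avg setT (fun p : 'S_n => (tau (p @: U) G y)%:R) + eps.
Proof.
have [b [br b_dec b0 b_pl]] := @plateau R delta Q delta_gt0 (std_energy R q G H)
  max_palette (fun _ _ _ => introT andP (conj (energy_ge0 _ _ _) (energy_le1 _ _ _)))
  (fun j b b' c h => std_energy_mono R q G H j c (proj1 (andP h)))
  r.+1 0%N (leqnn _).
have qM : (max_palette + r <= q)%N.
  by apply: leq_trans (leq_maxl _ _); apply: leq_addr.
have b0q : (b 0%N + Q <= q)%N by apply: leq_trans (leq_trans b0 _) qM; rewrite leq_addr.
pose P := seg n (b 0%N).
have cP : #|P| = b 0%N by apply: card_seg; lia.
have exS (W : E) : (#|W| <= q)%N -> exists S : E, W \subset S /\ #|S| = q.
  by move=> Wq; apply: (@superset_of_card n W q); rewrite Wq q_le_n.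
pose Sf (f : E) : E := odflt set0 [pick S : E | (P :|: f \subset S) && (#|S| == q)].
have SfP (f : E) : (#|f| <= r)%N -> P :|: f \subset Sf f /\ #|Sf f| = q.
  move=> fr; rewrite /Sf; case: pickP => [S /andP[? /eqP]//|no].
  have [|S [PS cS]] := exS (P :|: f).
    by apply: leq_trans (leq_card_setU _ _) _; rewrite cP; lia.
  by have := no S; rewrite PS cS eqxx.
pose psi (U : E) (x : {ffun E -> C}) (y : {ffun E -> D}) : R := (tau U x y)%:R.
pose good := [set U : E | (#|U| == Q) && [disjoint U & P]].
(* The start is arbitrary: the schedule overwrites every color on which the test of a good [U]
   depends. *)
pose y0 : {ffun E -> D} := H set0.
have step (U S : E) : U \in good -> P :|: U \subset S -> #|S| = q ->
  avg setT (fun p : 'S_n => (tau (p @: U) G (H (p @: S)))%:R) <=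
  avg setT (fun p => resample_all G H b Sf (base G p) (schedule n r b)
     (psi U (base G p)) y0) + eps / 2.
  rewrite inE => /andP[/eqP cU UP] PS cS.
  pose L := [seq f : E <- schedule n r b | f \subset U].
  have tL : terminal r U L by apply: terminal_schedule.
  have ag x x' y y' : agree r b U [::] x x' y y' -> psi U x y = psi U x' y'.
    move=> [xx yy]; congr (_%:R); rewrite (@tau_local U x x' y y') // => e eU er.
    have eP : e :\: P = e.
      by apply/setDidPl; apply: disjointWl UP.
    split; first by apply: xx; apply: subset_trans eU (subsetUr _ _).
    apply: yy => //; rewrite /in_blocks eP eU er /visible -/P.
    rewrite (disjoint_setI0 (disjointWl eU UP)); exact: sub0set.
  have psi01 x y : 0 <= psi U x y <= 1 by rewrite ler0n lern1 leq_b1.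
  have := @resample_all_ge R C D n q r G H b Q delta step_eps step_eps_gt0
    (fun _ => erefl) q_le_n b0q (fun j jr => b_dec j jr) (fun j jr => b_pl j jr)
    U S Sf (psi U) UP PS cS (eq_leq cU) (fun f _ => SfP f) ag psi01 L tL.
  have -> : avg setT (fun p => psi U (base G p) (sample H S p)) =
      avg setT (fun p : 'S_n => (tau (p @: U) G (H (p @: S)))%:R).
    by apply: eq_avg => p _; rewrite tau_inv.
  have -> : avg setT (fun p => resample_all G H b Sf (base G p) L
      (psi U (base G p)) (sample H S p)) =
    avg setT (fun p => resample_all G H b Sf (base G p) (schedule n r b)
      (psi U (base G p)) y0).
    apply: eq_avg => p _; rewrite [RHS](@resample_all_filter _ _ _ _ _ _ _ U).
      apply: (resample_all_agree G H Sf ag tL); split=> // e /and3P[eU er _].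
      rewrite mem_filter eU mem_schedule er andbT /=.
      by rewrite disjoints_subset setDE subsetIr.
    move=> y1 y2 y12; rewrite /psi (@tau_local U _ (base G p) _ y2) // => e eU _.
    split=> //.
    by apply: y12; apply: subset_trans (subsetDl _ _) eU.
  move=> /le_trans; apply; rewrite lerD2l.
  have : (size L)%:R <= (2 ^ Q)%:R :> R by rewrite ler_nat -cU; apply: size_schedule.
  move=> /(ler_wpM2r (ltW step_eps_gt0)) /le_trans; apply.
  by rewrite mulrC divfK // pnatr_eq0 -lt0n expn_gt0.
pose Phi (z : 'S_n * {ffun E -> D}) : R :=
  \sum_(U in good) psi U (base G z.1) z.2.
pose z := [arg max_(z > (1%g, y0)) Phi z]%O.
have zmax z' : Phi z' <= Phi z.
  by rewrite /z; case: arg_maxP => // w _; apply.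
pose y : {ffun E -> D} := [ffun e : E => z.2 (z.1^-1%g @: e)].
have tau_z U : tau U (base G z.1) z.2 = tau (z.1 @: U) G y.
  rewrite tau_inv; congr tau; apply/ffunP => e.
  by rewrite [RHS]ffunE [RHS]ffunE imset_permK.
exists y => S U US cS cU.
set V := avg setT _.
have V01 : 0 <= V <= 1.
  by rewrite avg_ge0 ?avg_le // => p _; rewrite ?ler0n ?lern1 ?leq_b1.
pose all_Q := [set U' : E | #|U'| == Q].
have all_gt0 : 0 < #|all_Q|%:R :> R.
  by rewrite ltr0n card_gt0; apply/set0Pn; exists U; rewrite inE cU.
(* [V] depends only on the sizes of [S] and [U], so [step] compares every good [U'], inside a
   suitable [S'], with the same [V]. *)
have PhiV : #|good|%:R * (V - eps / 2) <= Phi z.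
  apply: (@le_trans _ _ (\sum_(U' in good)
    avg setT (fun p => resample_all G H b Sf (base G p) (schedule n r b)
     (psi U' (base G p)) y0))).
    rewrite mulr_natl -sumr_const; apply: ler_sum => U' U'g.
    have [|S' [PS' cS']] := exS (P :|: U').
      move: U'g; rewrite inE => /andP[/eqP cU' _].
      by apply: leq_trans (leq_card_setU _ _) _; rewrite cP cU'.
    rewrite lerBlDr; apply: le_trans (step _ _ U'g PS' cS').
    rewrite le_eqVlt; apply/orP; left; apply/eqP.
    rewrite /V (avg_imset2 (fun S U => (tau U G (H S))%:R) US).
    rewrite (avg_imset2 (fun S U => (tau U G (H S))%:R)); last first.
      exact: subset_trans (subsetUr _ _) PS'.
    by move: U'g; rewrite inE cS cS' cU => /andP[/eqP-> _].
  rewrite -avg_sum; apply: avg_le => [|p _].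
    by apply: sumr_ge0 => U' _; rewrite ler0n.
  rewrite -resample_all_sum.
  have [] := andP (@resample_all_bounds R C D n G H b Sf (base G p) (schedule n r b)
    (fun y' => \sum_(U' in good) psi U' (base G p) y') y0 0 (Phi z) _) => //.
  move=> y'; rewrite (zmax (p, y')) andbT.
  by apply: sumr_ge0 => U' _; rewrite ler0n.
have good_all : #|all_Q|%:R * (1 - eps / 2) <= #|good|%:R :> R.
  have meets := avg_meets R U P.
  rewrite (avg_imset U (fun U' => (~~ [disjoint U' & P])%:R : R)) cU cP in meets.
  have : avg all_Q (fun U' => (~~ [disjoint U' & P])%:R : R) <= eps / 2.
    apply: le_trans meets _; rewrite mulrA -natrM.
    have n0 : 0 < n%:R :> R.
      by rewrite ltr0n; apply: leq_trans q_le_n; apply: leq_trans (leq_maxr _ _).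
    rewrite ler_pdivrMr // mulrC -ler_pdivrMr ?divr_gt0 //.
    apply: (@le_trans _ _ ((Q * max_palette)%:R / (eps / 2))).
      rewrite ler_pM2r ?invr_gt0 ?divr_gt0 // ler_nat leq_mul2l; apply/orP; right.
      by apply: leq_trans b0; rewrite leq_addr.
    apply: (@le_trans _ _ (Num.bound ((Q * max_palette)%:R / (eps / 2)))%:R).
      by apply/ltW/archi_boundP; rewrite divr_ge0 ?ler0n // divr_ge0 // ltW.
    by rewrite ler_nat; apply: leq_trans q_le_n; rewrite leq_maxr.
  rewrite /avg ler_pdivrMr // => le_meet.
  have -> : #|good|%:R = #|all_Q|%:R -
      \sum_(U' in all_Q) (~~ [disjoint U' & P])%:R :> R.
    rewrite -!sum1_card !natr_sum -sumrB big_mkcond [RHS]big_mkcond.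
    apply: eq_bigr => U' _; rewrite !inE; case: (#|U'| == Q) => //=.
    by case: [disjoint U' & P]; rewrite ?subr0 ?subrr.
  lra.
rewrite (avg_imset U (fun U' => (tau U' G y)%:R : R)) cU -/all_Q.
have Phi_le : Phi z <= \sum_(U' : E | U' \in all_Q) (tau U' G y)%:R.
  rewrite [leRHS](reindex (fun U' : E => z.1 @: U')) /=; last first.
    by exists (fun U' : E => z.1^-1%g @: U') => U' _; rewrite ?imset_permK ?imset_permKV.
  rewrite /Phi /= [leLHS]big_mkcond [leRHS]big_mkcond /=; apply: ler_sum => U' _.
  rewrite !inE card_imset_perm /psi tau_z.
  by case: (#|U'| == Q) => //=; case: ifP; rewrite ?ler0n.
rewrite -lerBlDr /avg ler_pdivlMr //.
have /andP[V0 V1] := V01.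
(* If [V <= eps / 2] the bound is trivial. Otherwise [V - eps / 2] is a positive factor, and
   [(1 - eps / 2) * (V - eps / 2) >= V - eps] because [V <= 1]. *)
have [Ve|Ve] := lerP V (eps / 2).
  apply: (@le_trans _ _ 0); last by apply: sumr_ge0 => U' _; rewrite ler0n.
  by apply: mulr_le0_ge0; [lra | exact: ltW].
apply: le_trans Phi_le; apply: le_trans PhiV.
apply: (@le_trans _ _ ((#|all_Q|%:R * (1 - eps / 2)) * (V - eps / 2))); last first.
  by rewrite ler_wpM2r // subr_ge0 ltW.
rewrite mulrC -mulrA ler_pM2l //.
have Veps : V * eps <= eps by rewrite ler_piMl // ltW.
by have := sqr_ge0 eps; lra.
Qed.

End Transfer.

(** * Graph parameters *)

Section Pullbacks.
Variables (R : realType) (C : finType) (r : nat).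

Lemma cpullback_comp m k n (h : 'I_m -> 'I_k) (h_inj : injective h)
    (l : 'I_k -> 'I_n) (l_inj : injective l) (c : cgraph C r n) :
  cpullback h_inj (cpullback l_inj c) = cpullback (inj_comp l_inj h_inj) c.
Proof.
apply/ffunP => e; rewrite !ffunE; congr (c _); apply: val_inj.
by rewrite /= -imset_comp.
Qed.

(** Injections with the same image differ by a permutation of the domain, under which [g] is
    invariant. *)
Lemma cparam_pullback (g : cparam R C r) m1 m2 n (c : cgraph C r n)
    (h1 : 'I_m1 -> 'I_n) (h1_inj : injective h1)
    (h2 : 'I_m2 -> 'I_n) (h2_inj : injective h2) :
  h1 @: setT = h2 @: setT ->
  g m1 (cpullback h1_inj c) = g m2 (cpullback h2_inj c).
Proof.
move=> e12; have m12 : m1 = m2.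
  by rewrite -(card_ord m1) -(card_ord m2) -!cardsT -(card_imset _ h1_inj) e12
    card_imset.
subst m2.
have lift_h i : exists j, h2 j == h1 i.
  have : h1 i \in h2 @: setT by rewrite -e12 imset_f.
  by case/imsetP => j _ ->; exists j.
pose s0 i := xchoose (lift_h i).
have s0P i : h2 (s0 i) = h1 i by apply/eqP/(xchooseP (lift_h i)).
have s0_inj : injective s0.
  by move=> i j ij; apply: h1_inj; rewrite -!s0P ij.
rewrite -[RHS](cparam_relabel g (perm s0_inj)); congr (g _ _).
rewrite /crelabel cpullback_comp; apply/ffunP => e; rewrite !ffunE; congr (c _).
by apply: val_inj; apply: eq_imset => i /=; rewrite permE s0P.
Qed.

Lemma imset_enum_val n (U : {set 'I_n}) : enum_val @: [set: 'I_#|U|] = U.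
Proof.
apply/setP => i; apply/imsetP/idP => [[j _ ->]|iU]; first exact: enum_valP.
by exists (enum_rank_in iU i); rewrite ?enum_rankK_in.
Qed.

Lemma cparam_induced2 (g : cparam R C r) n (c : cgraph C r n) (S : {set 'I_n})
    (T : {set 'I_#|S|}) :
  g #|T| (cinduced (cinduced c S) T) =
  g #|enum_val @: T| (cinduced c (enum_val @: T)).
Proof.
rewrite /cinduced cpullback_comp; apply: cparam_pullback.
by rewrite imset_comp !imset_enum_val.
Qed.

Lemma cparam_induced_perm (g : cparam R C r) n (c : cgraph C r n) (s : 'S_n)
    (U : {set 'I_n}) :
  g #|s @: U| (cinduced c (s @: U)) = g #|U| (cinduced (crelabel s c) U).
Proof.
rewrite /cinduced /crelabel cpullback_comp; apply: cparam_pullback.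
by rewrite [RHS]imset_comp !imset_enum_val.
Qed.

Lemma sample_probE n q (A : pred {set 'I_n}) :
  sample_prob R q A = avg [set S : {set 'I_n} | #|S| == q] (fun S => (A S)%:R).
Proof.
rewrite /sample_prob /avg; congr (_ / _).
rewrite -sum1_card natr_sum big_mkcond [RHS]big_mkcond; apply: eq_bigr => S _.
by rewrite !inE; case: (#|S| == q) => //=; case: (A S).
Qed.

Lemma avg_subsets n (S : {set 'I_n}) q (F : {set 'I_n} -> R) :
  avg [set U : {set 'I_n} | (#|U| == q) && (U \subset S)] F =
  avg [set T : {set 'I_#|S|} | #|T| == q] (fun T => F (enum_val @: T)).
Proof.
have inj : injective (fun T : {set 'I_#|S|} => [set enum_val i | i in T] : {set 'I_n}).
  exact/imset_inj/enum_val_inj.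
rewrite (_ : [set U : {set 'I_n} | _] =
  [set [set enum_val i | i in T] |
     T : {set 'I_#|S|} in [set T : {set 'I_#|S|} | #|T| == q]]).
  by rewrite /avg big_imset ?card_imset //; apply: in2W.
apply/setP => U; rewrite inE; apply/andP/imsetP => [[cU US]|[T]].
  have UE : [set enum_val i | i in enum_val @^-1: U : {set 'I_#|S|}] = U.
    apply/setP => i; apply/imsetP/idP => [[j]|iU]; first by rewrite inE => ? ->.
    have iS := subsetP US i iU.
    by exists (enum_rank_in iS i); rewrite ?inE enum_rankK_in.
  exists (enum_val @^-1: U) => //.
  by rewrite inE -(card_imset _ (@enum_val_inj _ (mem S))) UE.
rewrite inE => /eqP cT ->; rewrite card_imset ?cT; last exact: enum_val_inj.
by split=> //; apply/subsetP => _ /imsetP[i _ ->]; apply: enum_valP.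
Qed.

End Pullbacks.

(** * Edge colorings as functions on all vertex sets *)

Section Colorings.
Variables (T : Type) (r n : nat).

(** The resampling colors vertex sets of every size; those that are not edges get the dummy color
    [t0]. *)
Definition extend (t0 : T) (c : redge r 'I_n -> T) : {ffun {set 'I_n} -> T} :=
  [ffun e => if insub e is Some e' then c e' else t0].

Lemma extendE t0 c (e : redge r 'I_n) : extend t0 c (val e) = c e.
Proof. by rewrite ffunE valK. Qed.

End Colorings.

Section Join.
Variables (C D : finType) (r n : nat).
Implicit Types (x : {ffun {set 'I_n} -> C}) (y : {ffun {set 'I_n} -> D}).

Definition join_colors x y : cgraph (C * D)%type r n :=
  [ffun e => (x (val e), y (val e))].

Lemma join_colors_perm (s : 'S_n) x y :
  join_colors [ffun e : {set 'I_n} => x (s @: e)] [ffun e : {set 'I_n} => y (s @: e)] =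
  crelabel s (join_colors x y).
Proof. by apply/ffunP => e; rewrite !ffunE. Qed.

Lemma eq_join_induced x x' y y' (U : {set 'I_n}) :
  (forall e : {set 'I_n}, e \subset U -> (#|e| <= r)%N -> x e = x' e /\ y e = y' e) ->
  cinduced (join_colors x y) U = cinduced (join_colors x' y') U.
Proof.
move=> h; apply/ffunP => e; rewrite !ffunE /=.
have [||-> -> //] := h (enum_val @: val e).
  by apply/subsetP => _ /imsetP[i _ ->]; apply: enum_valP.
by rewrite card_imset ?(eqP (valP e)) //; apply: enum_val_inj.
Qed.

End Join.

(** * Optimal colorings of a graph and of its samples *)

Section Witness.
Variables (R : realType) (r k : nat) (k_gt0 : (0 < k)%N).
Variables (f : sparam R r) (g : cparam R ('I_2 * 'I_k)%type r).
Hypothesis fg : forall n (G : sgraph r n),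
  is_max (fun H => kcoloring (two_colored G) H) (fun H => g n H) (f n G).
Variables (n : nat) (G : sgraph r n).

Let d0 : 'I_k := Ordinal k_gt0.
Let x : {ffun {set 'I_n} -> 'I_2} := extend ord0 (two_colored G).

Definition witness_graph (y : {ffun {set 'I_n} -> 'I_k}) := join_colors r x y.

Lemma witness_graph_coloring y : kcoloring (two_colored G) (witness_graph y).
Proof. by move=> e; rewrite ffunE /= /x extendE. Qed.

Lemma witness_graph_le y : g n (witness_graph y) <= f n G.
Proof. by have [_ max] := fg G; apply/max/witness_graph_coloring. Qed.

Lemma witness_graph_max : exists y, g n (witness_graph y) = f n G.
Proof.
have [[c [cG <-]] _] := fg G.
exists (extend d0 (fun e => (c e).2)); congr (g _ _); apply/ffunP => e.
by rewrite ffunE /x !extendE -cG -surjective_pairing.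
Qed.

Lemma induced_two_colored (S : {set 'I_n}) (e : redge r 'I_#|S|) :
  two_colored (sinduced G S) e = x (enum_val @: val e).
Proof.
rewrite -[enum_val @: _]/(val (map_redge (@enum_val_inj _ (mem S)) e)) /x extendE.
by rewrite !ffunE inE.
Qed.

Lemma witness_induced_le (S : {set 'I_n}) y :
  g #|S| (cinduced (witness_graph y) S) <= f #|S| (sinduced G S).
Proof.
have [_ max] := fg (sinduced G S); apply: max => e.
by rewrite induced_two_colored !ffunE.
Qed.

Lemma witness_induced_max (S : {set 'I_n}) :
  exists y, g #|S| (cinduced (witness_graph y) S) = f #|S| (sinduced G S).
Proof.
have [[c [cG <-]] _] := fg (sinduced G S).
(* The optimal coloring lives on the renamed vertices of [S]; preimages under [enum_val] turn it
   into a coloring of the vertex sets of [G]. *)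
pose y : {ffun {set 'I_n} -> 'I_k} := [ffun e : {set 'I_n} =>
  extend d0 (fun e' => (c e').2) (enum_val @^-1: e : {set 'I_#|S|})].
exists y; congr (g _ _); apply/ffunP => e.
rewrite [RHS]surjective_pairing cG induced_two_colored ffunE [LHS]ffunE.
congr pair; rewrite ffunE.
have -> : enum_val @^-1: (enum_val @: val e) = val e.
  by apply/setP => i; rewrite inE mem_imset //; apply: enum_val_inj.
by rewrite extendE.
Qed.

End Witness.

Theorem theorem2p3 (R : realType) (r : nat) (hr : (1 <= r)%N) (f : sparam R r) :
  nondet_testable f -> testable f.
Proof.
case=> k [k0 [g [g_test fg]]] eps eps0.
(* Five errors of size [eta] are added below, three from sampling and two from the transfer, and
   [5 * eta < eps] strictly. *)
pose eta : R := eps / 6.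
have eta0 : 0 < eta by rewrite divr_gt0.
have [Q [Q0 gQ]] := g_test eta eta0.
pose q := transfer_size ('I_k) Q r eta.
have Qq : (Q <= q)%N by apply: leq_transfer_size.
have D0 : (0 < #|'I_k|)%N by rewrite card_ord.
exists q; split=> [|n G qn]; first exact: leq_trans Q0 Qq.
pose x : {ffun {set 'I_n} -> 'I_2} := extend ord0 (two_colored G).
pose val_at y (U : {set 'I_n}) : R := g #|U| (cinduced (witness_graph G y) U).
pose far y (U : {set 'I_n}) := eta < `|g n (witness_graph G y) - val_at y U|.
have far_le y (U0 : {set 'I_n}) : #|U0| = Q ->
    avg setT (fun p : 'S_n => (far y (p @: U0))%:R) <= eta.
  move=> cU; rewrite (avg_imset U0 (fun U => (far y U)%:R : R)) cU.
  rewrite -(sample_probE _ _ (far y)); apply/ltW/gQ.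
  exact: leq_trans Qq qn.
pose far_in y (S U : {set 'I_n}) := eta < `|val_at y S - val_at y U|.
have far_in_le (Y : {set 'I_n} -> {ffun {set 'I_n} -> 'I_k}) (S0 U0 : {set 'I_n}) :
    #|S0| = q -> #|U0| = Q -> U0 \subset S0 ->
    avg setT (fun p : 'S_n => (far_in (Y (p @: S0)) (p @: S0) (p @: U0))%:R) <= eta.
  move=> cS cU US.
  apply: (avg_imset2_le (F := fun S U => (far_in (Y S) S U)%:R : R)) => // S.
  rewrite cS cU => cS'; rewrite avg_subsets.
  have QS : (Q <= #|S|)%N by rewrite cS'.
  have /ltW := gQ _ (cinduced (witness_graph G (Y S)) S) QS; apply: le_trans.
  rewrite sample_probE le_eqVlt; apply/orP; left; apply/eqP.
  by apply: eq_avg => T _; rewrite /far_in /val_at -cparam_induced2.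
have [y best_y] := witness_graph_max k0 fg G.
have [Y bestY] := fin_all_exists (witness_induced_max k0 fg G).
(* Detects [Q]-samples whose coloring looks too good for [G]. *)
pose tau (U : {set 'I_n}) x' y' :=
  f n G + eta < g #|U| (cinduced (join_colors r x' y') U).
have tau_local (U : {set 'I_n}) (x1 x2 : {ffun {set 'I_n} -> 'I_2})
    (y1 y2 : {ffun {set 'I_n} -> 'I_k}) :
  (forall e : {set 'I_n}, e \subset U -> (#|e| <= r)%N ->
     x1 e = x2 e /\ y1 e = y2 e) -> tau U x1 y1 = tau U x2 y2.
  by move=> h; rewrite /tau (eq_join_induced h).
have tau_inv (p : 'S_n) (U : {set 'I_n}) (x' : {ffun {set 'I_n} -> 'I_2})
    (y' : {ffun {set 'I_n} -> 'I_k}) : tau (p @: U) x' y' =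
    tau U [ffun e : {set 'I_n} => x' (p @: e)] [ffun e : {set 'I_n} => y' (p @: e)].
  by rewrite /tau cparam_induced_perm join_colors_perm.
have [z z_tau] := transfer D0 eta0 x Y qn tau_local tau_inv.
pose S0 := seg n q; pose U0 := seg n Q.
have cS : #|S0| = q by apply: card_seg.
have cU : #|U0| = Q by apply: card_seg; apply: leq_trans Qq qn.
have US : U0 \subset S0 by apply: seg_sub.
rewrite sample_probE -cS -avg_imset.
have h1 := far_le y U0 cU.
have h2 := far_in_le (fun=> y) S0 U0 cS cU US.
have h3 := far_in_le Y S0 U0 cS cU US.
have h4 := z_tau S0 U0 US cS cU.
(* As [witness_graph G z] is a coloring of [G], its value is at most [f n G], so a sample that
   passes the test is far from it. *)
have h5 : avg setT (fun p : 'S_n => (tau (p @: U0) x z)%:R) <= eta.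
  apply: le_trans (far_le z U0 cU); apply: le_avg => p _.
  rewrite ler_nat; case: (boolP (tau _ x z)) => // taup; rewrite lt0b /far.
  have fz := witness_graph_le fg G z.
  have {taup} : f n G + eta < val_at z (p @: U0) by [].
  move: fz; move: (g n _) (val_at _ _) => a c fz ac.
  by rewrite distrC lter_normr; apply/orP; left; lra.
have cover (b b1 b2 b3 b4 : bool) : (b -> [|| b1, b2, b3 | b4]) ->
    b%:R <= b1%:R + b2%:R + b3%:R + b4%:R :> R.
  rewrite -!natrD ler_nat.
  by case: b b1 b2 b3 b4 => [] [] [] [] [] // /(_ isT).
pose far4 (p : 'S_n) := (far y (p @: U0))%:R + (far_in y (p @: S0) (p @: U0))%:R +
  (far_in (Y (p @: S0)) (p @: S0) (p @: U0))%:R +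
  (tau (p @: U0) x (Y (p @: S0)))%:R : R.
(* Outside the four events, restricting [y] bounds the value of the sample below by
   [f n G - 2 * eta], and the optimal [Y] bounds it above by [f n G + 2 * eta]. *)
apply: (@le_lt_trans _ _ (avg setT far4)).
  apply: le_avg => p _; apply: cover; apply: contraTT.
  rewrite !negb_or -!leNgt => /and4P[f1 f2 f3 f4].
  have yS : val_at y (p @: S0) <= f _ (sinduced G (p @: S0)).
    exact: witness_induced_le.
  have YS : val_at (Y (p @: S0)) (p @: S0) = f _ (sinduced G (p @: S0)).
    exact: bestY.
  have {}f4 : val_at (Y (p @: S0)) (p @: U0) <= f n G + eta by [].
  move: f1 f2 f3; rewrite best_y !ler_norml -YS => f1 f2 f3.
  move: (val_at y (p @: S0)) (val_at y (p @: U0)) yS f1 f2 => a c yS f1 f2.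
  move: (val_at _ _) (val_at _ _) YS f3 f4 yS => b d YS f3 f4 yS.
  by rewrite /eta in f1 f2 f3 f4; lra.
have etaE : eps = 6 * eta by rewrite /eta; field.
have avg4 : avg setT far4 <= eta + eta + eta + (eta + eta).
  rewrite /far4 !avgD !lerD //.
  by apply: le_trans h4 _; rewrite lerD2r.
by apply: le_lt_trans avg4 _; lra.
Qed.
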